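(* Let $G_k$ be a sequence of finite connected graphs, each with a distinguished vertex $v_k$. Let $A_k$ be the collection of neighbors of $v_k$ in $G_k$ (other than $v_k$, listed with multiplicity if there are parallel edges), and let $1+D_k$ be the random degree of $v_k$ in the uniform random spanning tree on $G_k$. Let $\epsilon_k\to0$ be a sequence of positive numbers, and let $W_k=A_k\cup\{v_k\}$. Assume there is a constant $C$, independent of $k$, such that for all (non-self) edges $e$ (with endpoints $x,y$) and $f$ (with endpoints $z,w$) of $G_k$ with $x,y,z,w\in W_k$ and with all neighbors of $x$ in $W_k$, $$\Big|M(e,f)-\sum_{q\in e\cap f}\deg_*(q)^{-1}\Big|\le C\,\epsilon_k\sum_{q\in e}\deg_*(q)^{-1}.$$ If in addition $\sum_{w\in A_k}\deg_*(w)^{-1}\to\lambda$ as $k\to\infty$ for some positive $\lambda$, then $D_k$ converges in distribution to a Poisson random variable with mean $\lambda$.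
   Context: For a vertex $x$ of a finite graph, $\deg_*(x)$ is the number of edges incident to $x$ that are not self-edges. Sums over $q\in e$ are over the two endpoints of $e$, and $e\cap f$ is the set of endpoints common to $e$ and $f$. The transfer impedance $M(e,f)$ of two oriented edges $e=\vec{xy}$, $f=\vec{zw}$ of a finite connected graph is $\phi(z)-\phi(w)$, where $\phi$ is the function on vertices (unique up to an additive constant) with $\sum_{\text{edges } ab}(\phi(a)-\phi(b))=\delta_x(a)-\delta_y(a)$ for every vertex $a$ (sum over edges at $a$); equivalently, it is the expected signed number of transits of $f$ by simple random walk started at $x$ and stopped on hitting $y$. In the displayed hypothesis, $e$ and $f$ are oriented so that at a common endpoint they either both point away from it or both point towards it (with $e=f$ given the same orientation); orientation is immaterial when they share no endpoint. *)

(* Defs.v *)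
From HB Require Import structures.
From mathcomp Require Import all_boot all_order all_algebra.
From mathcomp Require Import all_classical all_reals all_analysis.

Set Implicit Arguments.
Unset Strict Implicit.
Unset Printing Implicit Defensive.

Import Order.TTheory GRing.Theory Num.Theory.
Import numFieldNormedType.Exports.

Local Open Scope ring_scope.

(* Finite multigraphs: parallel edges and self-edges are allowed. The maps src
   and tgt fix a reference orientation of each edge, with no other meaning. *)
Record mgraph := MGraph {
  vertex : finType;
  edge : finType;
  src : edge -> vertex;
  tgt : edge -> vertex }.

Section Graph.
Variable G : mgraph.

(* Oriented edges: (e, true) is e with its reference orientation and (e, false)
   is e reversed, so a self-edge also carries two of them. *)
Definition dart := (edge G * bool)%type.

Definition dtail (d : dart) : vertex G := if d.2 then src d.1 else tgt d.1.
Definition dhead (d : dart) : vertex G := if d.2 then tgt d.1 else src d.1.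

Definition endpoints (d : dart) : {set vertex G} :=
  [set dtail d; dhead d]%SET.

Definition deg_star (x : vertex G) : nat :=
  #|[set e : edge G | (src e != tgt e) && ((src e == x) || (tgt e == x))]%SET|.

(* The neighbors of x other than x, listed with multiplicity. *)
Definition neighbors (x : vertex G) : seq (vertex G) :=
  [seq dhead d | d <- enum [set d : dart | (dtail d == x) && (dhead d != x)]%SET].

Definition closed_nbhd (x : vertex G) : seq (vertex G) := x :: neighbors x.

(* Spanning subgraphs, given by their edge sets. *)
Definition subgraph := {set edge G}.

HB.instance Definition _ := Finite.on subgraph.
HB.instance Definition _ := isPointed.Build subgraph finset.set0.
HB.instance Definition _ := @isMeasurable.Build default_measure_display
  subgraph discrete_measurable discrete_measurable0
  discrete_measurableC discrete_measurableU.

Definition adjacent (T : {set edge G}) : rel (vertex G) :=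
  fun x y => [exists d : dart, [&& d.1 \in T, dtail d == x & dhead d == y]].

Definition connected_sub (T : {set edge G}) : bool :=
  [forall x, forall y, connect (adjacent T) x y].

(* A self-edge is a cycle of length 1 and two parallel edges form a cycle of
   length 2; going back and forth along one edge is not a cycle. *)
Definition simple_cycle (c : seq dart) : bool :=
  [&& c != [::], path.cycle (fun d d' => dhead d == dtail d') c,
      uniq [seq d.1 | d <- c] & uniq [seq dtail d | d <- c]].

Definition acyclic (T : {set edge G}) : Prop :=
  forall c : seq dart, simple_cycle c -> ~~ all (fun d => d.1 \in T) c.

Definition spanning_trees : {set {set edge G}} :=
  [set T | connected_sub T && `[< acyclic T >]]%SET.

Definition degree (T : {set edge G}) (x : vertex G) : nat :=
  #|[set d : dart | (d.1 \in T) && (dtail d == x)]%SET|.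

Definition is_ust (R : realType) d (Omega : measurableType d)
    (P : probability Omega R) (T : {RV P >-> subgraph}) : Prop :=
  forall t : {set edge G}, P (T @^-1` [set t])%classic =
    (if t \in spanning_trees then (#|spanning_trees|%:R : R)^-1 else 0)%:E.

Definition unit_flow_potential (R : realType) (x y : vertex G)
    (phi : {ffun vertex G -> R}) : Prop :=
  forall a, \sum_(d : dart | dtail d == a) (phi a - phi (dhead d)) =
            (a == x)%:R - (a == y)%:R.

(* On a connected graph the potential exists and is unique up to an additive
   constant, so the value below does not depend on the choice made by xget and
   the default 0 is never used. *)
Definition transfer_impedance (R : realType) (e f : dart) : R :=
  let phi := xget [ffun=> 0] (@unit_flow_potential R (dtail e) (dhead e)) in
  phi (dtail f) - phi (dhead f).

(* At each common endpoint both darts point away or both point towards it. *)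
Definition co_oriented (e f : dart) : Prop :=
  forall q, q \in (endpoints e :&: endpoints f)%SET ->
    (dtail e = q /\ dtail f = q) \/ (dhead e = q /\ dhead f = q).

End Graph.

Definition connected_graph (G : mgraph) : bool := connected_sub [set: edge G]%SET.

Section Probability.
Local Open Scope classical_set_scope.
Variable R : realType.

Definition cvg_in_distribution (d : nat -> measure_display)
    (Omega : forall k, measurableType (d k))
    (P : forall k, probability (Omega k) R) (X : forall k, {RV (P k) >-> R})
    (d' : measure_display) (Omega' : measurableType d')
    (Q : probability Omega' R) (Y : {RV Q >-> R}) : Prop :=
  forall r : R, {for r, continuous (cdf Y)} ->
    cdf (X k) r @[k --> \oo] --> cdf Y r.

Definition nat_to_real (n : nat) : R := n%:R.

Lemma measurable_nat_to_real : measurable_fun [set: nat] nat_to_real.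
Proof. by []. Qed.

HB.instance Definition _ :=
  isMeasurableFun.Build _ _ _ _ nat_to_real measurable_nat_to_real.

(* The identity on the probability space (nat, Poisson law). The nat argument
   of poisson_prob is a dummy: the measure does not depend on it. *)
Definition poisson_rv (lambda : R) : {RV (poisson_prob lambda 0%N) >-> R} :=
  nat_to_real.

End Probability.

(* Main.v *)
(** Write N for the degree of v in the random tree T, and give the edges at v the
    weight z.  By the matrix-tree theorem, E z^N = det (1 + (z - 1) A G), where G
    is the Green function of the Laplacian grounded at v and A is the diagonal
    matrix counting the edges from each vertex to v.  The eigenvalues mu_i of A G
    lie in [0, 1], since A is dominated by the grounded Laplacian as a quadratic
    form; hence N is distributed as a sum of independent Bernoulli variables of
    means mu_i, and one of the mu_i is 1 because N >= 1.

    For edges e, f out of v, M(e, f) is the value of G at their other endpoints,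
    so that tr (A G) = sum_e M(e, e) and tr ((A G)^2) = sum_(e, f) M(e, f)^2.
    The hypothesis makes M(e, f) close to 1 / deg_* v, plus 1 / deg_* w when e and
    f have the same head w.  The rows of the symmetric matrix M(e, f) sum to 1,
    which forces the weights (multiplicity of w) / deg_* w to be uniformly small;
    therefore sum mu_i -> 1 + lambda and sum mu_i^2 -> 1.  Apart from the
    eigenvalue 1 this is the Poisson regime: E z^N -> z exp (lambda (z - 1)) for
    0 < z < 1, and convergence of generating functions near 0 gives that of their
    coefficients. *)

Require Import Defs.
From HB Require Import structures.
From mathcomp Require Import all_boot all_order all_algebra.
From mathcomp Require Import fingroup perm.
From mathcomp Require Import ring lra.
From mathcomp Require Import spectral complex.
From mathcomp Require Import all_classical all_reals all_analysis.

Set Implicit Arguments.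
Unset Strict Implicit.
Unset Printing Implicit Defensive.

Import Order.TTheory GRing.Theory Num.Theory.
Import numFieldNormedType.Exports.

Local Open Scope classical_set_scope.
Local Open Scope ring_scope.

(** * Determinants of functional graphs *)

(** Multilinearity in the rows: expanding the Leibniz formula picks one summand [f i] in each row
    [i]. *)
Lemma det_sum_rows (R : comNzRingType) (O : finType) n
    (c : 'I_n -> O -> R) (r : 'I_n -> O -> 'I_n -> R) :
  \det (\matrix_(i, j) \sum_o c i o * r i o j) =
  \sum_(f : {ffun 'I_n -> O})
    (\prod_i c i (f i)) * \det (\matrix_(i, j) r i (f i) j).
Proof.
rewrite [LHS](_ : _ = \sum_(s : 'S_n) \sum_(f : {ffun 'I_n -> O})
   (-1) ^+ s * \prod_i (c i (f i) * r i (f i) (s i))); last first.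
  apply: eq_bigr => s _; rewrite -big_distrr /=; congr (_ * _).
  under eq_bigr do rewrite mxE.
  by rewrite bigA_distr_bigA.
rewrite exchange_big; apply: eq_bigr => f _.
rewrite /determinant big_distrr /=; apply: eq_bigr => s _.
rewrite big_split /= mulrCA; congr (_ * (_ * _)).
by apply: eq_bigr => i _; rewrite mxE.
Qed.

Section FunctionalGraph.
Variables (V : finType) (v : V) (nx : V -> V).

(** The bound on [k] makes the property boolean; [reachesP] removes it when [nx] fixes [v]. *)
Definition reaches : bool :=
  [forall x, [exists k : 'I_#|V|.+1, iter k nx x == v]].

Lemma iter_reach_bound x k : iter k nx x = v -> nx v = v ->
  exists k' : 'I_#|V|.+1, iter k' nx x == v.
Proof.
move=> kv vv.
have : v \in orbit nx x.
  by rewrite -fconnect_orbit -kv fconnect_iter.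
rewrite -fconnect_orbit => xv.
have lt : (findex nx x v < #|V|.+1)%N.
  by rewrite ltnS; apply: leq_trans (max_card _); apply/ltnW/findex_max.
by exists (Ordinal lt); rewrite /= iter_findex.
Qed.

Lemma reachesP : nx v = v ->
  reflect (forall x, exists k, iter k nx x = v) reaches.
Proof.
move=> vv; apply: (iffP forallP) => H x.
  by have /existsP[k /eqP kv] := H x; exists k.
by apply/existsP; have [k kv] := H x; apply: iter_reach_bound kv vv.
Qed.

(** The matrix is the identity minus the arcs of [nx] that avoid [v]. If every point reaches [v],
    only the identity permutation contributes; otherwise the indicator of the points that never
    reach [v] lies in the kernel. *)
Lemma det_functional_graph (R : idomainType) : nx v = v ->
  \det (\matrix_(i < #|V|, j < #|V|)
    ((enum_val i == enum_val j)%:R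
      - ((enum_val i != v) && (nx (enum_val i) == enum_val j) &&
         (enum_val j != v))%:R)) = reaches%:R :> R.
Proof.
move=> vv; case: reachesP => //= [reach|nreach].
- rewrite /determinant (bigD1 1%g) //= [X in _ + X]big1 ?addr0 => [|s s1].
  + rewrite odd_perm1 expr0 mul1r big1 // => i _; rewrite mxE perm1 eqxx.
    case: eqP => //= xv; first by rewrite subr0.
    case: eqP => //= nxx; last by rewrite subr0.
    have [k kv] := reach (enum_val i).
    by case: xv; rewrite -kv; elim: (k) => //= m <-.
  + have [i0 si0] : exists i, s i != i.
      apply/existsP; rewrite -negb_forall; apply: contra s1 => /forallP H.
      by apply/eqP/permP => i; rewrite perm1; apply/eqP.
    (* A nonzero term makes [s] follow [nx] at the points it moves, so the orbit of [i0] stays among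
       moved points and never meets [v]. *)
    set F := \prod_i _; have [/prodf_neq0 F0|/negPn/eqP->] := boolP (F != 0);
      last by rewrite mulr0.
    suff : False by [].
    have step i : s i != i -> [/\ enum_val i != v,
        nx (enum_val i) = enum_val (s i) & enum_val (s i) != v].
      move=> si; have := F0 i isT; rewrite mxE.
      rewrite (inj_eq enum_val_inj) [i == _]eq_sym (negPf si) sub0r oppr_eq0.
      case H: (_ && _ && _); last by rewrite eqxx.
      by move: H => /andP[/andP[? /eqP ?] ?].
    have moved k : s (iter k s i0) != iter k s i0.
      by elim: k => //= k IH; rewrite (inj_eq perm_inj).
    have it k : iter k nx (enum_val i0) = enum_val (iter k s i0).
      by elim: k => //= k ->; case: (step _ (moved k)).
    have [k] := reach (enum_val i0); rewrite it.
    by apply/eqP; case: (step _ (moved k)).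
- rewrite -det_tr; apply/eqP/det0P.
  pose U x := `[< forall k, iter k nx x <> v >].
  have Uv : U v = false.
    by apply/negbTE/asboolPn => /(_ 0%N).
  have Unx x : x != v -> U (nx x) = U x.
    move=> xv; apply/asboolP/asboolP => H k.
    + by case: k => [/eqP|k]; [rewrite (negPf xv)|rewrite iterSr; exact: H].
    + by rewrite -iterSr; exact: H.
  have [x0 Ux0] : exists x, U x.
    apply: contrapT => H; apply: nreach => x; apply: contrapT => nx0.
    by apply: H; exists x; apply/asboolP => k kv; apply: nx0; exists k.
  exists (\row_i (U (enum_val i))%:R).
    apply/eqP => /rowP /(_ (enum_rank x0)); rewrite !mxE enum_rankK Ux0.
    by apply/eqP; rewrite oner_eq0.
  apply/rowP => i; rewrite !mxE.
  under eq_bigr => j _ do rewrite !mxE mulrBr.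
  rewrite sumrB (bigD1 i) //= eqxx mulr1 big1 ?addr0; last first.
    by move=> j ji; rewrite (inj_eq enum_val_inj) eq_sym (negPf ji) mulr0.
  have [xv|xv] := boolP (enum_val i == v).
    by rewrite /= (eqP xv) Uv big1 ?subr0// => j _; rewrite mulr0.
  rewrite (bigD1 (enum_rank (nx (enum_val i)))) //= enum_rankK eqxx big1 ?addr0.
    have := Unx _ xv; have [-> <-|_ ->] := eqVneq (nx _) v.
      by rewrite Uv /= mulr0 subr0.
    by rewrite mulr1 subrr.
  move=> j ji; have [/= e|_] := eqVneq; last by rewrite mulr0.
  by move: ji; rewrite e enum_valK eqxx.
Qed.
End FunctionalGraph.

(** * The matrix-tree theorem *)

Lemma uniq_map_inj_in (T1 T2 : eqType) (f : T1 -> T2) (s : seq T1) :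
  uniq (map f s) -> {in s &, injective f}.
Proof.
elim: s => //= a s IH /andP[fa us] x y; rewrite !inE.
move=> /predU1P[->|xs] /predU1P[->|ys] fxy //; last exact: IH.
- by move: fa; rewrite fxy map_f.
- by move: fa; rewrite -fxy map_f.
Qed.

(** The least number of steps to [v] is such a height, and a strictly decreasing height can only
    stop at [v]. Acyclicity and injectivity below run on [h]. *)
Lemma reaches_height (V : finType) (v : V) (nx : V -> V) : nx v = v ->
  reaches v nx <-> exists h : V -> nat, forall x, x != v -> (h (nx x) < h x)%N.
Proof.
move=> vv; split.
  move=> /(reachesP vv) reach.
  have ex x : exists k, iter k nx x == v.
    by have [k /eqP] := reach x; exists k.
  exists (fun x => ex_minn (ex x)) => x xv.
  case: ex_minnP => m _ mmin; case: ex_minnP => [[|k]]; first by rewrite (negPf xv).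
  by rewrite iterSr => /mmin; rewrite ltnS.
move=> [h hlt]; apply/(reachesP vv) => x.
elim: {x}(h x).+1 {-2}x (ltnSn (h x)) => // n IH x; rewrite ltnS => hx.
have [->|/hlt hx'] := eqVneq x v; first by exists 0%N.
have [k] := IH _ (leq_trans hx' hx).
by exists k.+1; rewrite iterSr.
Qed.

(** * Parent maps toward the root and the trees they encode *)

Section Arborescences.
Variables (G : mgraph) (v : vertex G).
Local Notation V := (vertex G).
Local Notation adjacent := Defs.adjacent.

Definition drev (d : dart G) : dart G := (d.1, ~~ d.2).

Lemma dtail_rev d : dtail (drev d) = dhead d. Proof. by case: d => e []. Qed.
Lemma dhead_rev d : dhead (drev d) = dtail d. Proof. by case: d => e []. Qed.
Lemma drevK : involutive drev. Proof. by case=> e []. Qed.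
Lemma drev_neq d : drev d != d. Proof. by case: d => e []; apply/eqP => -[]. Qed.

Lemma same_edge (d d' : dart G) : d.1 = d'.1 -> d' = d \/ d' = drev d.
Proof. by case: d d' => e [] [e' []] /= ->; [left|right|right|left]. Qed.

Lemma adjacent_sym (T : {set edge G}) : symmetric (adjacent T).
Proof.
move=> x y; apply/existsP/existsP => -[d /and3P[dT /eqP<- /eqP<-]];
  by exists (drev d); rewrite dtail_rev dhead_rev !eqxx dT.
Qed.

(* A spanning tree is encoded by the map sending [v] to [None] and any other
   vertex to the first dart of its path to [v]. *)
Definition parent (f : {ffun V -> option (dart G)}) (x : V) : V :=
  if f x is Some d then dhead d else v.

Definition out_map (f : {ffun V -> option (dart G)}) : bool :=
  [forall x, if f x is Some d then (x != v) && (dtail d == x) else x == v].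

Definition arborescence f : bool := out_map f && reaches v (parent f).

Definition tree_of (f : {ffun V -> option (dart G)}) : {set edge G} :=
  [set e | [exists x, exists b, f x == Some (e, b)]]%SET.

Lemma out_map_root f : out_map f -> f v = None.
Proof. by move=> /forallP/(_ v); case: (f v) => // d; rewrite eqxx. Qed.

Lemma out_map_dart f x d : out_map f -> f x = Some d -> x != v /\ dtail d = x.
Proof. by move=> /forallP/(_ x); case: (f x) => // d' /andP[? /eqP ?] [<-]. Qed.

Lemma out_map_some f x : out_map f -> x != v -> exists d, f x = Some d.
Proof. by move=> /forallP/(_ x); case: (f x) => [d|->//]; exists d. Qed.

Lemma parent_root f : out_map f -> parent f v = v.
Proof. by rewrite /parent => /out_map_root ->. Qed.

Lemma tree_ofP f (d : dart G) : out_map f -> d.1 \in tree_of f ->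
  f (dtail d) = Some d \/ f (dhead d) = Some (drev d).
Proof.
move=> fo; rewrite inE => /existsP[x /existsP[b /eqP fx]].
have [_ tx] := out_map_dart fo fx.
have [e|e] : (d.1, b) = d \/ (d.1, b) = drev d by exact: same_edge.
  by left; rewrite e in fx tx; rewrite tx.
by right; rewrite e in fx tx; rewrite dtail_rev in tx; rewrite tx.
Qed.

Lemma tree_of_dart (f : {ffun V -> option (dart G)}) x d :
  f x = Some d -> d.1 \in tree_of f.
Proof.
move=> fx; rewrite inE; apply/existsP; exists x; apply/existsP; exists d.2.
by rewrite fx -surjective_pairing.
Qed.

Section Arborescence.
Variables (f : {ffun V -> option (dart G)}) (fo : out_map f) (h : V -> nat).
Hypothesis h_parent : forall x, x != v -> (h (parent f x) < h x)%N.

Lemma height_dart x d : f x = Some d -> (h (dhead d) < h x)%N.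
Proof.
move=> fx; have [xv _] := out_map_dart fo fx.
by have := h_parent xv; rewrite /parent fx.
Qed.

Lemma tree_of_connected : connected_sub (tree_of f).
Proof.
have cv x : connect (adjacent (tree_of f)) x v.
  elim: {x}(h x).+1 {-2}x (ltnSn (h x)) => // n IH x; rewrite ltnS => hx.
  have [->//|xv] := eqVneq x v.
  have [d fx] := out_map_some fo xv; have [_ tx] := out_map_dart fo fx.
  apply: connect_trans (IH (dhead d) (leq_trans (height_dart fx) hx)).
  apply: connect1; apply/existsP; exists d.
  by rewrite (tree_of_dart fx) tx !eqxx.
apply/forallP => x; apply/forallP => y; apply: connect_trans (cv x) _.
by rewrite (sym_connect_sym (adjacent_sym _)).
Qed.

(** Take the dart [d] of the cycle whose tail is highest. Since parent darts descend, both [d] and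
    the reverse of its predecessor must be the parent dart of that tail; they then share an edge, so
    [d] is its own predecessor and its own reverse. *)
Lemma tree_of_acyclic : acyclic (tree_of f).
Proof.
move=> c /and4P[c0 cyc uE _]; apply/negP => /allP cT.
have [d0 d0c] : exists d, d \in c.
  by case: c c0 {cyc uE cT} => // d s _; exists d; rewrite mem_head.
pose d := [arg max_(i > d0 | i \in c) h (dtail i)].
have [dc dmax] : d \in c /\ forall d', d' \in c -> (h (dtail d') <= h (dtail d))%N.
  by rewrite /d; case: arg_maxnP.
have /eqP hd := next_cycle cyc dc.
have /eqP pd := prev_cycle cyc dc.
set d1 := prev c d in pd.
have d1c : d1 \in c by rewrite mem_prev.
have fd : f (dtail d) = Some d.
  have [//|/height_dart] := tree_ofP fo (cT _ dc).
  by rewrite dhead_rev hd ltnNge dmax // mem_next.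
have [/height_dart|] := tree_ofP fo (cT _ d1c).
  by rewrite pd ltnNge dmax.
rewrite pd fd => -[e].
have dd1 : d = d1.
  apply: (uniq_map_inj_in uE) => //; by rewrite e.
by have := drev_neq d1; rewrite -e -dd1 eqxx.
Qed.

Lemma tree_of_spanning : tree_of f \in @spanning_trees G.
Proof.
rewrite inE tree_of_connected; apply/asboolP; exact: tree_of_acyclic.
Qed.

End Arborescence.
End Arborescences.

(** * Spanning trees correspond to arborescences *)

Section SpanningTrees.
Variables (G : mgraph) (v : vertex G).
Local Notation V := (vertex G).
Local Notation adjacent := Defs.adjacent.
Implicit Types f g : {ffun V -> option (dart G)}.

(** The root has no parent dart, so every tree edge at [v] is the parent dart of its other
    endpoint. *)
Lemma degree_tree_of f : out_map v f ->
  degree (tree_of f) v = #|[set x | (x != v) && (parent v f x == v)]%SET|.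
Proof.
move=> fo; rewrite /degree.
set D := [set d : dart G | _]%SET.
have rev_dart d : d \in D -> f (dhead d) = Some (drev d).
  rewrite inE => /andP[dT /eqP td].
  by case: (tree_ofP fo dT) => [|->//]; rewrite td (out_map_root fo).
rewrite -(@card_in_imset _ _ (@dhead G) (mem D)); last first.
  move=> d d' /rev_dart fd /rev_dart fd' e.
  by apply: (can_inj (@drevK G)); apply: Some_inj; rewrite -fd -fd' e.
apply: eq_card => x; apply/imsetP/idP => [[d dD ->]|].
  have fd := rev_dart _ dD; have [dv _] := out_map_dart fo fd.
  move: dD; rewrite !inE dv /parent fd dhead_rev => /andP[_ ->] //.
rewrite inE => /andP[xv]; have [d fx] := out_map_some fo xv.
have [_ tx] := out_map_dart fo fx.
rewrite /parent fx => hd; exists (drev d); last by rewrite dhead_rev.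
by rewrite inE dtail_rev hd andbT; exact: tree_of_dart fx.
Qed.

Lemma arborescenceP f : reflect (out_map v f /\
    exists h : V -> nat, forall x, x != v -> (h (parent v f x) < h x)%N)
  (arborescence v f).
Proof.
apply: (iffP andP) => -[fo r]; split=> //.
  by apply/(reaches_height (parent_root fo)).
by apply/(reaches_height (parent_root fo)).
Qed.

(** Induction on the height for [f]. The edge of the parent dart [d] of [x] also comes from [g];
    were it used there by the head of [d], reversed, then [f] would use it so as well by induction,
    and the height would both fall and rise along it. *)
Lemma tree_of_inj :
  {in [set f | arborescence v f]%SET &, injective (@tree_of G)}.
Proof.
move=> f g; rewrite !inE => /arborescenceP[fo [h hp]] /arborescenceP[go [k kp]] fg.
apply/ffunP => x; elim: {x}(h x).+1 {-2}x (ltnSn (h x)) => // n IH x.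
rewrite ltnS => hx.
have [->|xv] := eqVneq x v; first by rewrite !(out_map_root _).
have [d fx] := out_map_some fo xv; have [_ tx] := out_map_dart fo fx.
have := tree_of_dart fx; rewrite fg => /(tree_ofP go); rewrite tx fx.
case=> // gd; have hd := height_dart fo hp fx.
have := IH _ (leq_trans hd hx); rewrite gd => /(height_dart fo hp).
by rewrite dhead_rev tx ltnNge ltnW.
Qed.

(** Meant for closing a path into a cycle: the fourth clause attaches a dart at both ends. Distinct
    vertices give distinct edges, since repeating the first edge in either direction would revisit
    [x]. *)
Lemma path_darts (T : {set edge G}) x p : path (adjacent T) x p ->
  exists ds : seq (dart G),
  [/\ all (fun d => d.1 \in T) ds, map (@dtail G) ds = belast x p,
      map (@dhead G) ds = p,
      forall d d', dhead d = x -> dtail d' = last x p ->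
        path (fun d d' => dhead d == dtail d') d (rcons ds d')
    & uniq (x :: p) -> uniq [seq d.1 | d <- ds]].
Proof.
elim: p x => [|y p IH] x /=.
  by move=> _; exists [::]; split=> //= d d' -> ->; rewrite eqxx.
move=> /andP[/existsP[d0 /and3P[d0T /eqP t0 /eqP h0]] /IH[ds [dT tds hds dp du]]].
exists (d0 :: ds); split; rewrite /= ?d0T ?t0 ?h0 ?tds ?hds //.
  by move=> d d' dx dl; rewrite dx eqxx dp.
move=> /andP[xyp uyp]; rewrite du // andbT.
apply: contra xyp => /mapP[d1 d1ds /same_edge[]] e1.
  by rewrite -t0 -e1 mem_belast // -tds map_f.
by rewrite -t0 -dhead_rev -e1 inE -hds map_f ?orbT.
Qed.

(** The distance to [v] inside [T] works: the first dart of a shortest path lowers it. *)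
Lemma connected_height (T : {set edge G}) : connected_sub T ->
  exists h : V -> nat, forall x, x != v ->
    exists d : dart G, [/\ d.1 \in T, dtail d = x & (h (dhead d) < h x)%N].
Proof.
move=> Tc.
have ex x : exists n, `[< exists p, [/\ path (adjacent T) x p,
    last x p = v & size p = n] >].
  have /forallP/(_ x)/forallP/(_ v)/connectP[p xp vp] := Tc.
  by exists (size p); apply/asboolP; exists p.
exists (fun x => ex_minn (ex x)) => x xv.
case: ex_minnP => m /asboolP[[|y p] [] /=]; first by move=> _ xv'; rewrite xv' eqxx in xv.
move=> /andP[/existsP[d /and3P[dT /eqP tx /eqP hy]] yp] lv <- _.
exists d; split=> //; case: ex_minnP => k _ /(_ (size p)); rewrite ltnS; apply.
by apply/asboolP; exists p; rewrite hy.
Qed.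

Lemma spanning_tree_of (T : {set edge G}) : connected_sub T ->
  exists f, arborescence v f /\ tree_of f \subset T.
Proof.
move=> /connected_height[h hT].
pose f : {ffun V -> option (dart G)} := [ffun x => if x == v then None else
  [pick d : dart G | [&& d.1 \in T, dtail d == x & (h (dhead d) < h x)%N]]].
have fP x : x != v -> exists d : dart G,
    [/\ f x = Some d, d.1 \in T, dtail d = x & (h (dhead d) < h x)%N].
  move=> xv; rewrite ffunE (negPf xv).
  case: pickP => [d /and3P[dT /eqP tx hd]|no]; first by exists d.
  by have [d [dT tx hd]] := hT _ xv; have := no d; rewrite dT tx hd eqxx.
have fv : f v = None by rewrite ffunE eqxx.
have fo : out_map v f.
  apply/forallP => x; have [->|xv] := eqVneq x v; first by rewrite fv.
  by have [d [-> _ -> _]] := fP _ xv; rewrite eqxx.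
exists f; split.
  apply/arborescenceP; split=> //; exists h => x /fP[d [fx _ _ hd]].
  by rewrite /parent fx.
apply/fintype.subsetP => e; rewrite inE => /existsP[x /existsP[b /eqP fx]].
have [xv _] := out_map_dart fo fx.
by have [d [fx' dT _ _]] := fP _ xv; move: fx' dT; rewrite fx => -[<-].
Qed.

(** [T] contains the tree of some [f]. An edge of [T] outside that tree would close a cycle with the
    simple tree path between its endpoints, which is empty for a self-edge. *)
Lemma tree_of_surj (T : {set edge G}) : T \in @spanning_trees G ->
  exists2 f, arborescence v f & tree_of f = T.
Proof.
rewrite inE => /andP[Tc /asboolP Ta].
have [f [fa fT]] := spanning_tree_of Tc; exists f => //.
have /arborescenceP[fo [h hp]] := fa.
apply/eqP; rewrite finset.eqEsubset fT /=; apply/fintype.subsetP => e eT.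
apply: contraT => enT; pose d : dart G := (e, true).
have /forallP/(_ (dhead d))/forallP/(_ (dtail d))/connectP[p0 dp0 lp0] :=
  tree_of_connected fo hp.
case/shortenP: dp0 lp0 => p pT pu _ lp.
have [ds [dsT tds hds dp du]] := path_darts pT.
have := Ta (d :: ds); rewrite /= eT /= => /(_ _)/negP; case; last first.
  by apply: sub_all dsT => d' /(fintype.subsetP fT).
apply/and4P; split=> //=.
- exact: dp.
- rewrite du // andbT; apply/negP => /mapP[d' d'ds ed].
  by move/allP: dsT => /(_ _ d'ds); rewrite -ed (negPf enT).
- by rewrite tds lp -rcons_uniq -lastI.
Qed.
End SpanningTrees.

Lemma big_option (R : Type) (idx : R) (op : Monoid.com_law idx) (T : finType)
    (F : option T -> R) :
  \big[op/idx]_o F o = op (F None) (\big[op/idx]_(d : T) F (Some d)).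
Proof.
rewrite (bigD1 None) //=; congr (op _ _).
rewrite (reindex_omap Some id) /=; last by case.
by apply: eq_bigl => d; rewrite eqxx.
Qed.

(** * Expansion of the grounded determinant over parent maps *)

Section MatrixTree.
Variables (G : mgraph) (v : vertex G).
Local Notation V := (vertex G).

(* The Laplacian of [G] grounded at [v], with the darts into [v] weighted by [z];
   the row and the column of [v] are replaced by those of the identity. *)
Definition kirchhoff (R : pzRingType) (z : R) (x y : V) : R :=
  if x == v then (y == v)%:R else
  \sum_(d : dart G | dtail d == x) (if dhead d == v then z else 1) *
    ((x == y)%:R - ((dhead d == y) && (y != v))%:R).

Definition kirchhoff_mx (R : pzRingType) (z : R) : 'M[R]_#|V| :=
  \matrix_(i, j) kirchhoff z (enum_val i) (enum_val j).

Lemma prod_enum_val (R : comPzRingType) (F : V -> R) :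
  \prod_(i < #|V|) F (enum_val i) = \prod_x F x.
Proof. by rewrite -(big_enum_val F); apply: eq_bigl. Qed.

(** Each row is a sum over the darts leaving a vertex, so multilinearity yields a sum over choices
    of one dart per vertex. Each choice contributes the determinant of a functional graph, which
    selects the arborescences, with a factor [z] per child of the root. *)
Theorem matrix_tree (R : idomainType) (z : R) :
  \det (kirchhoff_mx z) =
  \sum_(T in @spanning_trees G) z ^+ degree T v.
Proof.
pose w (d : dart G) : R := if dhead d == v then z else 1.
(* The coefficient [c] vanishes unless [o] is a dart leaving [x], or [None] at the root, so all rows
   share one index type. *)
pose c x (o : option (dart G)) : R := if o is Some d then
  ((x != v) && (dtail d == x))%:R * w d else (x == v)%:R.
pose r x (o : option (dart G)) y : R := (x == y)%:R -
  ((x != v) && ((if o is Some d then dhead d else v) == y) && (y != v))%:R.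
have -> : kirchhoff_mx z = \matrix_(i, j) \sum_o
    c (enum_val i) o * r (enum_val i) o (enum_val j).
  apply/matrixP => i j; rewrite !mxE; move: (enum_val i) (enum_val j) => x y.
  rewrite big_option /= /kirchhoff /c /r.
  have [->|xv] := eqVneq x v; rewrite /= ?mul1r ?mul0r ?subr0 ?add0r.
    by rewrite big1 ?addr0 1?eq_sym // => d _; rewrite !mul0r.
  rewrite big_mkcond; apply: eq_bigr => d _.
  by case: ifP => _; rewrite ?mul1r ?mul0r.
rewrite (det_sum_rows (fun i => c (enum_val i))
  (fun i o j => r (enum_val i) o (enum_val j))).
pose F (f : {ffun V -> option (dart G)}) : {ffun 'I_#|V| -> option (dart G)} :=
  [ffun i => f (enum_val i)].
rewrite (reindex F); last first.
  exists (fun g : {ffun 'I_#|V| -> option (dart G)} =>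
    [ffun x => g (enum_rank x)] : {ffun V -> option (dart G)}) => f _;
    by apply/ffunP => x; rewrite !ffunE ?enum_rankK ?enum_valK.
rewrite (eq_bigr (fun f => if arborescence v f then z ^+ degree (tree_of f) v
  else 0)) => [|f _].
  rewrite -big_mkcond /= -big_set /=.
  rewrite -(big_imset (fun T : {set edge G} => z ^+ degree T v)
     (@tree_of_inj G v)) /=.
  apply: eq_bigl => T; apply/imsetP/idP => [[f]|].
    by rewrite inE => /arborescenceP[fo [h hp]] ->; exact: (tree_of_spanning fo hp).
  by move=> /(tree_of_surj v)[f fa <-]; exists f; rewrite ?inE.
under eq_bigr do rewrite ffunE.
rewrite (prod_enum_val (fun x => c x (f x))) /arborescence.
have [fo|nfo] := boolP (out_map v f); last first.
  have [x] : exists x, ~~ (if f x is Some d then (x != v) && (dtail d == x) else x == v).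
    by apply/existsP; rewrite -negb_forall.
  move=> fx; rewrite (bigD1 x) //= /c; case: (f x) fx => [d|] /negPf-> /=;
    by rewrite !mul0r.
rewrite degree_tree_of //.
have -> : \prod_x c x (f x) = z ^+ #|[set x | (x != v) && (parent v f x == v)]%SET|.
  rewrite -prodr_const [RHS]big_mkcond /=; apply: eq_bigr => x _.
  rewrite inE /parent.
  have [->|xv] := eqVneq x v; first by rewrite (out_map_root fo) /= eqxx.
  have [d fx] := out_map_some fo xv; have [_ tx] := out_map_dart fo fx.
  by rewrite fx /= xv tx eqxx mul1r.
rewrite (_ : matrix_of_fun _ _ = \matrix_(i < #|V|, j < #|V|)
    ((enum_val i == enum_val j)%:R - ((enum_val i != v) &&
      (parent v f (enum_val i) == enum_val j) && (enum_val j != v))%:R)).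
  rewrite (det_functional_graph R (parent_root fo)).
  by case: reaches; rewrite ?mulr1 ?mulr0.
by apply/matrixP => i j; rewrite !mxE ffunE.
Qed.
End MatrixTree.

(** * Generalized eigenvalues of a pair of quadratic forms *)

Lemma conj_mulmx (F : fieldType) n (P A B : 'M[F]_n) : P \in unitmx ->
  (invmx P *m A *m P) *m (invmx P *m B *m P) = invmx P *m (A *m B) *m P.
Proof. by move=> Pu; rewrite -!mulmxA mulKVmx. Qed.

Section GeneralizedEigenvalues.
Variable R : rcfType.
Local Notation C := (complex R).
Local Notation toC := (real_complex R).

Definition qform n (A : 'M[R]_n) (u : 'rV[R]_n) : R := (u *m A *m u^T) 0 0.

Lemma Re_mulmx m n (w : 'M[C]_(1, m)) (A : 'M[R]_(m, n)) :
  map_mx (@complex.Re R) (w *m map_mx toC A) = map_mx (@complex.Re R) w *m A.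
Proof.
apply/matrixP => i j; rewrite !mxE raddf_sum; apply: eq_bigr => k _.
by rewrite !mxE; case: (w i k) => a b /=; rewrite mulr0 subr0.
Qed.

Lemma Im_mulmx m n (w : 'M[C]_(1, m)) (A : 'M[R]_(m, n)) :
  map_mx (@complex.Im R) (w *m map_mx toC A) = map_mx (@complex.Im R) w *m A.
Proof.
apply/matrixP => i j; rewrite !mxE raddf_sum; apply: eq_bigr => k _.
by rewrite !mxE; case: (w i k) => a b /=; rewrite mulr0 add0r.
Qed.

Lemma form_sym n (A : 'M[R]_n) (x y : 'rV[R]_n) : A^T = A ->
  x *m A *m y^T = y *m A *m x^T.
Proof.
move=> sA; have -> : y *m A *m x^T = (x *m A *m y^T)^T.
  by rewrite !trmx_mul trmxK sA mulmxA.
by apply/matrixP => i j; rewrite !ord1 [RHS]mxE.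
Qed.

Variables (n : nat) (L m : 'M[R]_n).
Hypotheses (L_sym : L^T = L) (m_sym : m^T = m) (L_unit : L \in unitmx).
Hypothesis m_ge0 : forall u, 0 <= qform m u.
Hypothesis m_le_L : forall u, qform m u <= qform L u.
Hypothesis L_def : forall u, qform L u = 0 -> u = 0.

(** Split [w] and [nu] into real and imaginary parts. Symmetry of [m] and [L] gives
    [b * (qform L x + qform L y) = 0], so [b = 0] by definiteness, and [a] is then a Rayleigh
    quotient of [m] by [L]. *)
Lemma generalized_eigenvalue_real (nu : C) (w : 'rV[C]_n) : w != 0 ->
  w *m map_mx toC m = nu *: (w *m map_mx toC L) ->
  exists2 a : R, 0 <= a <= 1 & nu = toC a.
Proof.
move=> w0 eqw; pose x := map_mx (@complex.Re R) w; pose y := map_mx (@complex.Im R) w.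
case: nu eqw => a b eqw.
have ex : x *m m = a *: (x *m L) - b *: (y *m L).
  rewrite -Re_mulmx eqw -Re_mulmx -Im_mulmx; apply/matrixP => i j.
  by rewrite !mxE; case: (\sum_(_ < _) _) => ? ?.
have ey : y *m m = a *: (y *m L) + b *: (x *m L).
  rewrite -Im_mulmx eqw -Re_mulmx -Im_mulmx; apply/matrixP => i j.
  by rewrite !mxE; case: (\sum_(_ < _) _) => ? ?.
have L_ge0 u : 0 <= qform L u by exact: le_trans (m_ge0 u) (m_le_L u).
have qLpos : 0 < qform L x + qform L y.
  rewrite lt0r addr_ge0 // andbT paddr_eq0 //.
  apply: contra w0 => /andP[/eqP/L_def x0 /eqP/L_def y0].
  apply/eqP/matrixP => i j; rewrite !mxE.
  move/matrixP: x0 => /(_ i j); move/matrixP: y0 => /(_ i j); rewrite !mxE.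
  by case: (w i j) => ? ? /= -> ->.
have xx : qform m x = a * qform L x - b * (y *m L *m x^T) 0 0.
  by rewrite /qform ex mulmxBl -!scalemxAl !mxE.
have yy : qform m y = a * qform L y + b * (y *m L *m x^T) 0 0.
  by rewrite /qform ey mulmxDl -!scalemxAl -(form_sym x y L_sym) !mxE.
have xy : b * (qform L x + qform L y) = 0.
  have := form_sym x y m_sym; rewrite ex ey mulmxBl mulmxDl -!scalemxAl.
  rewrite (form_sym x y L_sym) /qform.
  move: (x *m L *m x^T) (y *m L *m y^T) (y *m L *m x^T) => p q r.
  by move=> /matrixP/(_ 0 0); rewrite !mxE; lra.
have b0 : b = 0 by move/eqP: xy; rewrite mulf_eq0 (gt_eqF qLpos) orbF => /eqP.
exists a; last by rewrite b0.
have eq_a : qform m x + qform m y = a * (qform L x + qform L y).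
  by rewrite xx yy; ring.
have := m_ge0 x; have := m_ge0 y; have := m_le_L x; have := m_le_L y => ? ? ? ?.
rewrite -(pmulr_lge0 _ qLpos) -eq_a addr_ge0 //=.
by rewrite -(ler_pM2r qLpos) -eq_a mul1r lerD.
Qed.

(** [m *m invmx L] need not be symmetric, so it is triangularized over the complex numbers; its
    diagonal entries are eigenvalues of the pencil, hence real and in [0, 1]. *)
Lemma generalized_spectrum : exists mu : 'I_n -> R,
  [/\ forall i, 0 <= mu i <= 1,
      forall t, \det (1%:M + t *: (m *m invmx L)) = \prod_i (1 + t * mu i),
      \tr (m *m invmx L) = \sum_i mu i &
      \tr ((m *m invmx L) *m (m *m invmx L)) = \sum_i mu i ^+ 2].
Proof.
(* Schur triangularization is applied in positive dimension only. *)
case: (posnP n) => [n0|n_gt0].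
  have no (i : 'I_n) : False by move: (ltn_ord i); rewrite {2}n0.
  have mx0 (A B : 'M[R]_n) : A = B by apply/matrixP => i; case: (no i).
  exists (fun _ => 0); split; first by move=> i; case: (no i).
  - move=> t; rewrite (mx0 (_ + _) 1%:M) det1 big1 // => i; by case: (no i).
  - rewrite (mx0 (_ *m _) 0) mxtrace0 big1 // => i; by case: (no i).
  - rewrite (mx0 (_ *m _) 0) mxtrace0 big1 // => i; by case: (no i).
set A := m *m invmx L.
pose AC := map_mx toC A.
have [P /unitarymx_unit Pu] := Schur AC n_gt0.
rewrite /similar_to conjumx // => Ttrig.
set T := P *m AC *m invmx P in Ttrig.
have AT : AC = invmx P *m T *m P.
  by rewrite /T !mulmxA mulVmx // mul1mx -mulmxA mulVmx // mulmx1.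
clearbody T.
have det_conj (B : 'M[C]_n) : \det (invmx P *m B *m P) = \det B.
  by rewrite !det_mulmx mulrC mulrA -det_mulmx mulmxV // det1 mul1r.
have lin_conj (s t : C) : s%:M + t *: AC = invmx P *m (s%:M + t *: T) *m P.
  rewrite mulmxDr mulmxDl -scalemxAr -scalemxAl -AT; congr (_ + _).
  by rewrite -mulmxA -scalar_mxC mulmxA mulVmx // mul1mx.
have lin_trig (s t : C) : is_trig_mx (s%:M + t *: T).
  apply/is_trig_mxP => i j ij; rewrite !mxE (is_trig_mxP Ttrig) // mulr0 addr0.
  by rewrite -val_eqE /= (ltn_eqF ij).
have eig i : exists2 a : R, 0 <= a <= 1 & T i i = toC a.
  have : \det ((- T i i)%:M + 1 *: AC) = 0.
    rewrite lin_conj det_conj det_trig // (bigD1 i) //= !mxE eqxx.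
    by rewrite mul1r addNr mul0r.
  (* Multiplying the left eigenvector equation by [L] on the right gives an eigenvector of the
     pencil. *)
  move/eqP/det0P => [w w0]; rewrite scale1r mulmxDr => /eqP.
  rewrite mul_mx_scalar scaleNr addrC subr_eq0 => /eqP ew.
  apply: (generalized_eigenvalue_real w0).
  rewrite scalemxAl -ew -mulmxA -map_mxM /A -mulmxA mulVmx // mulmx1 //.
have [mu mu01 Tmu] : exists2 mu : 'I_n -> R,
    forall i, 0 <= mu i <= 1 & forall i, T i i = toC (mu i).
  by exists (fun i => sval (cid2 (eig i))) => i; case: cid2.
have trT (B : 'M[C]_n) : \tr (invmx P *m B *m P) = \tr B.
  by rewrite mxtrace_mulC mulmxA mulmxV // mul1mx.
exists mu; split=> //.
- move=> t; apply: (@complexI R); rewrite -det_map_mx map_mxD map_scalar_mx map_mxZ.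
  rewrite rmorph1 lin_conj det_conj det_trig // rmorph_prod.
  by apply: eq_bigr => i _; rewrite !mxE eqxx Tmu rmorphD rmorphM rmorph1.
- apply: (@complexI R); rewrite -trace_map_mx -/AC AT trT /mxtrace rmorph_sum.
  by apply: eq_bigr => i _; rewrite Tmu.
- apply: (@complexI R); rewrite -trace_map_mx map_mxM -/AC AT.
  rewrite conj_mulmx // trT /mxtrace rmorph_sum.
  apply: eq_bigr => i _; rewrite rmorphXn /= -Tmu mxE (bigD1 i) //= big1 ?addr0 //.
  (* One of [T i j] and [T j i] lies above the diagonal of a triangular matrix. *)
  move=> j; rewrite -val_eqE neq_ltn => /orP[ji|ij].
    by rewrite [T j i](is_trig_mxP Ttrig) // mulr0.
  by rewrite (is_trig_mxP Ttrig) // mul0r.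
Qed.
End GeneralizedEigenvalues.

(** * The grounded Laplacian and its Green function *)

Section Kirchhoff.
Variables (R : realType) (G : mgraph) (v : vertex G).
Local Notation V := (vertex G).

Lemma sum_drev (F : dart G -> R) : \sum_d F (drev d) = \sum_d F d.
Proof. by rewrite [RHS](reindex_inj (can_inj (@drevK G))). Qed.

(** The diagonal of the matrix [A]; the clause [x != v] discards self-edges at the root. *)
Definition root_mult (x : V) : nat :=
  #|[set d : dart G | [&& dtail d == x, dhead d == v & x != v]]%SET|.

Definition root_darts : {set dart G} :=
  [set d : dart G | (dtail d == v) && (dhead d != v)]%SET.

Lemma root_mult_sum x : (root_mult x)%:R =
  \sum_(d : dart G) ([&& dtail d == x, dhead d == v & x != v]%:R : R).
Proof.
rewrite /root_mult -sum1_card natr_sum big_mkcond /=.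
by apply: eq_bigr => d _; rewrite inE; case: ifP.
Qed.

(** Reversing darts trades edges into the root for darts out of it. *)
Lemma sum_root_mult (F : V -> R) :
  \sum_x (root_mult x)%:R * F x = \sum_(d in root_darts) F (dhead d).
Proof.
under eq_bigr do rewrite root_mult_sum big_distrl /=.
rewrite exchange_big /= -sum_drev [RHS]big_mkcond /=; apply: eq_bigr => d _.
rewrite (bigD1 (dhead d)) //= big1 ?addr0 => [|x xd].
  by rewrite dtail_rev dhead_rev eqxx inE /=; case: ifP; rewrite ?mul1r ?mul0r.
by rewrite dtail_rev eq_sym (negPf xd) mul0r.
Qed.

Lemma sum_neighbors (F : V -> R) :
  \sum_(x <- neighbors v) F x = \sum_(d in root_darts) F (dhead d).
Proof. by rewrite /neighbors big_map big_enum. Qed.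

(** Only the diagonal depends on [z], because a dart into [v] contributes to no off-diagonal
    entry. *)
Lemma kirchhoff_weight (z : R) x y :
  kirchhoff v z x y = kirchhoff v 1 x y + (z - 1) * ((root_mult x)%:R * (x == y)%:R).
Proof.
rewrite /kirchhoff root_mult_sum; have [->|xv] := eqVneq x v.
  rewrite [X in _ * (X * _)]big1 => [|d _]; last by rewrite !andbF.
  by rewrite mul0r mulr0 addr0.
rewrite big_mkcond [in RHS]big_mkcond /= big_distrl big_distrr -big_split /=.
apply: eq_bigr => d _; have [tx|_] := eqVneq (dtail d) x; last first.
  by rewrite /= mul0r mulr0 addr0.
have [hv|_] := eqVneq (dhead d) v; last by rewrite /= mul0r mulr0 addr0.
have -> : (dhead d == y) && (y != v) = false by rewrite hv; case: eqVneq.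
by rewrite /= !mulr1n mulr0n subr0; ring.
Qed.

(** Off the root, [kirchhoff] ignores the value [psi v] and acts as the Laplacian of this
    function. *)
Definition grounded (psi : V -> R) (x : V) : R := if x == v then 0 else psi x.

Lemma groundedE (psi : V -> R) x : psi v = 0 -> grounded psi x = psi x.
Proof. by rewrite /grounded; case: eqVneq => // ->. Qed.

Lemma sum_kirchhoff (psi : V -> R) x : x != v ->
  \sum_y kirchhoff v 1 x y * psi y =
  \sum_(d | dtail d == x) (grounded psi x - grounded psi (dhead d)).
Proof.
move=> xv; under eq_bigr do rewrite /kirchhoff (negPf xv) big_distrl /=.
rewrite exchange_big /=; apply: eq_bigr => d _.
under eq_bigr do rewrite if_same mul1r mulrBl.
rewrite sumrB (bigD1 x) //= eqxx mul1r big1 ?addr0 => [|y yx]; last first.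
  by rewrite eq_sym (negPf yx) mul0r.
rewrite /grounded (negPf xv); congr (_ - _).
rewrite (bigD1 (dhead d)) //= eqxx big1 ?addr0 => [|y yx]; last first.
  by rewrite eq_sym (negPf yx) mul0r.
by case: ifP; rewrite ?mul1r ?mul0r.
Qed.

Lemma sum_kirchhoff_root (psi : V -> R) :
  \sum_y kirchhoff v 1 v y * psi y = psi v.
Proof.
rewrite /kirchhoff eqxx (bigD1 v) //= eqxx mul1r big1 ?addr0 // => y yv.
by rewrite (negPf yv) mul0r.
Qed.

Lemma kirchhoff_sym x y : kirchhoff v (1 : R) x y = kirchhoff v 1 y x.
Proof.
rewrite /kirchhoff; have [xv|xv] := eqVneq x v; have [yv|yv] := eqVneq y v.
- by [].
- by rewrite big1 // => d _; rewrite andbF subr0 xv (negPf yv) mulr0.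
- by rewrite big1 // => d _; rewrite andbF yv (negPf xv) subr0 mulr0.
case: (eqVneq x y) => [->//|xy].
rewrite big_mkcond [RHS]big_mkcond /= -[RHS]sum_drev; apply: eq_bigr => d _.
rewrite dtail_rev dhead_rev !if_same !andbT.
by case: (dtail d == x); case: (dhead d == y); rewrite /= ?subrr ?mulr0.
Qed.

(** Summation by parts. The energy counts each edge once per dart, hence the factor 2; the term in
    [psi v] comes from the identity row. *)
Lemma kirchhoff_form (psi : V -> R) :
  2 * \sum_x psi x * (\sum_y kirchhoff v 1 x y * psi y) =
  2 * psi v ^+ 2 +
  \sum_(d : dart G) (grounded psi (dtail d) - grounded psi (dhead d)) ^+ 2.
Proof.
pose p := grounded psi.
have half : \sum_(x | x != v) psi x * (\sum_y kirchhoff v 1 x y * psi y) =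
    \sum_d p (dtail d) * (p (dtail d) - p (dhead d)).
  rewrite [RHS](partition_big (@dtail G) predT) //= [RHS](bigD1 v) //=.
  rewrite [X in _ = X + _]big1.
    rewrite add0r; apply: eq_bigr => x xv; rewrite sum_kirchhoff // big_distrr.
    apply: eq_bigr => d /eqP tx.
    by rewrite tx /p /= [X in _ = X * _]/grounded (negPf xv).
  by move=> d /eqP->; rewrite /p /grounded eqxx mul0r.
rewrite (bigD1 v) //= sum_kirchhoff_root half -expr2 mulrDr; congr (_ + _).
rewrite mulr_natl mulr2n -{2}sum_drev -big_split /=.
by apply: eq_bigr => d _; rewrite dtail_rev dhead_rev -/p; ring.
Qed.

(** In the energy, keep only the edges joining the root to another vertex: there the grounded
    difference is [psi] up to sign. *)
Lemma root_mult_form (psi : V -> R) :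
  2 * \sum_x (root_mult x)%:R * psi x ^+ 2 <=
  \sum_(d : dart G) (grounded psi (dtail d) - grounded psi (dhead d)) ^+ 2.
Proof.
have -> : \sum_x (root_mult x)%:R * psi x ^+ 2 =
    \sum_(d : dart G) (if d \in root_darts then psi (dhead d) ^+ 2 else 0).
  by rewrite (sum_root_mult (fun x => psi x ^+ 2)) big_mkcond.
rewrite mulr_natl mulr2n -{2}sum_drev -big_split /=.
apply: ler_sum => d _; rewrite !inE dtail_rev dhead_rev /grounded.
case: (eqVneq (dtail d) v) => _; case: (eqVneq (dhead d) v) => _ /=;
  rewrite ?(addr0, add0r, sub0r, subr0, sqrrN) //.
by rewrite sqr_ge0.
Qed.

End Kirchhoff.

(** * The Green function, transfer impedances and the spectrum *)

Section Green.
Variables (R : realType) (G : mgraph) (v : vertex G).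
Hypothesis G_conn : connected_graph G.
Local Notation V := (vertex G).
Local Notation K := (kirchhoff_mx v (1 : R)).

Lemma sum_enum_val (F : V -> R) : \sum_(i < #|V|) F (enum_val i) = \sum_x F x.
Proof. by rewrite -(big_enum_val F); apply: eq_bigl. Qed.

Lemma spanning_trees_gt0 : (0 < #|@spanning_trees G|)%N.
Proof.
have [f [/(arborescenceP v)[fo [h hp]] _]] := spanning_tree_of v G_conn.
apply/card_gt0P; exists (tree_of f); exact: (tree_of_spanning fo hp).
Qed.

Lemma det_kirchhoff : \det K = #|@spanning_trees G|%:R.
Proof.
rewrite matrix_tree -sum1_card natr_sum.
by apply: eq_bigr => T _; rewrite expr1n.
Qed.

Lemma kirchhoff_unit : K \in unitmx.
Proof.
by rewrite unitmxE unitfE det_kirchhoff pnatr_eq0 -lt0n spanning_trees_gt0.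
Qed.

Lemma kirchhoff_mx_sym : K^T = K.
Proof. by apply/matrixP => i j; rewrite !mxE kirchhoff_sym. Qed.

Definition root_mult_mx : 'M[R]_#|V| :=
  diag_mx (\row_i (root_mult v (enum_val i))%:R).

Lemma kirchhoff_mx_weight z : kirchhoff_mx v z = K + (z - 1) *: root_mult_mx.
Proof.
apply/matrixP => i j; rewrite !mxE kirchhoff_weight mulr_natr.
by rewrite (inj_eq enum_val_inj).
Qed.

(** Factor [K] out on the right of the weighted matrix; its determinant is the number of trees. *)
Lemma degree_pgf (z : R) :
  \sum_(T in @spanning_trees G) z ^+ degree T v =
  #|@spanning_trees G|%:R * \det (1%:M + (z - 1) *: (root_mult_mx *m invmx K)).
Proof.
rewrite -matrix_tree (kirchhoff_mx_weight z) -det_kirchhoff mulrC -det_mulmx.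
rewrite mulmxDl mul1mx -scalemxAl.
by rewrite mulmxKV // kirchhoff_unit.
Qed.

Definition fun_of_row (u : 'rV[R]_#|V|) (x : V) : R := u 0 (enum_rank x).

Lemma qform_kirchhoff u : qform K u =
  \sum_x fun_of_row u x * (\sum_y kirchhoff v 1 x y * fun_of_row u y).
Proof.
rewrite /qform mxE -sum_enum_val; apply: eq_bigr => i _.
rewrite !mxE mulrC /fun_of_row enum_valK; congr (_ * _).
rewrite -sum_enum_val; apply: eq_bigr => j _.
by rewrite !mxE enum_valK kirchhoff_sym mulrC.
Qed.

Lemma qform_root_mult u : qform root_mult_mx u =
  \sum_x (root_mult v x)%:R * fun_of_row u x ^+ 2.
Proof.
rewrite /qform mul_mx_diag mxE -sum_enum_val; apply: eq_bigr => i _.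
by rewrite !mxE /fun_of_row enum_valK; ring.
Qed.

Lemma qform_le u : qform root_mult_mx u <= qform K u.
Proof.
rewrite -(ler_pM2l (ltr0Sn R 1)) qform_root_mult qform_kirchhoff kirchhoff_form.
apply: le_trans (root_mult_form v (fun_of_row u)) _.
by rewrite lerDr mulr_ge0 // sqr_ge0.
Qed.

Lemma qform_root_mult_ge0 u : 0 <= qform root_mult_mx u.
Proof.
rewrite qform_root_mult; apply: sumr_ge0 => x _.
by rewrite mulr_ge0 // sqr_ge0.
Qed.

(** Zero energy forces the value 0 at the root and equal values across every dart, so [K] kills [u];
    invertibility of [K], known from the tree count, concludes. *)
Lemma qform_def u : qform K u = 0 -> u = 0.
Proof.
move=> q0; have := kirchhoff_form v (fun_of_row u).
rewrite -qform_kirchhoff q0 mulr0 => /esym/eqP.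
rewrite paddr_eq0; last 2 first.
- by rewrite mulr_ge0 // sqr_ge0.
- by apply: sumr_ge0 => d _; exact: sqr_ge0.
rewrite mulf_eq0 pnatr_eq0 /= sqrf_eq0 => /andP[/eqP uv].
rewrite psumr_eq0 => [/allP diff0|d _]; last exact: sqr_ge0.
suff uK : K *m u^T = 0.
  by apply: trmx_inj; rewrite trmx0 -[LHS](mulKmx kirchhoff_unit) uK mulmx0.
apply/matrixP => i j; rewrite !mxE.
transitivity (\sum_y kirchhoff v 1 (enum_val i) y * fun_of_row u y).
  rewrite -sum_enum_val; apply: eq_bigr => k _.
  by rewrite !mxE /fun_of_row enum_valK (ord1 j).
have [->|iv] := eqVneq (enum_val i) v; first by rewrite sum_kirchhoff_root uv.
rewrite sum_kirchhoff // big1 // => d /eqP <-.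
by have := diff0 d (mem_index_enum _); rewrite sqrf_eq0 => /eqP.
Qed.

Definition green (x y : V) : R := invmx K (enum_rank x) (enum_rank y).

Lemma green_sym x y : green x y = green y x.
Proof. by rewrite /green -{1}kirchhoff_mx_sym -trmx_inv mxE. Qed.

Lemma green_solve (psi F : V -> R) :
  (forall x, \sum_y kirchhoff v 1 x y * psi y = F x) ->
  forall x, psi x = \sum_y green x y * F y.
Proof.
move=> psiF x; pose pc : 'cV[R]_#|V| := \col_i psi (enum_val i).
have -> : psi x = (invmx K *m (K *m pc)) (enum_rank x) 0.
  by rewrite mulKmx ?kirchhoff_unit // mxE enum_rankK.
rewrite mxE -sum_enum_val; apply: eq_bigr => i _.
rewrite /green enum_valK; congr (_ * _).
rewrite mxE -psiF -sum_enum_val; apply: eq_bigr => j _.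
by rewrite !mxE.
Qed.

Lemma green_ex (F : V -> R) : exists psi : V -> R,
  forall x, \sum_y kirchhoff v 1 x y * psi y = F x.
Proof.
pose w := invmx K *m (\col_i F (enum_val i)).
exists (fun x => w (enum_rank x) 0) => x.
have : (K *m w) (enum_rank x) 0 = F x.
  by rewrite /w mulKVmx ?kirchhoff_unit // mxE enum_rankK.
move=> <-; rewrite mxE -sum_enum_val; apply: eq_bigr => i _.
by rewrite !mxE enum_rankK enum_valK.
Qed.

Lemma green_potential (psi : V -> R) (x : V) : psi v = 0 -> x != v ->
  (forall a, a != v -> \sum_(d : dart G | dtail d == a) (psi a - psi (dhead d)) =
                       (a == x)%:R) ->
  forall y, psi y = green y x.
Proof.
move=> pv xv psiE y.
rewrite (@green_solve psi (fun a => (a == x)%:R)).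
  rewrite (bigD1 x) //= eqxx mulr1 big1 ?addr0 // => z zx.
  by rewrite (negPf zx) mulr0.
move=> a; have [->|av] := eqVneq a v.
  by rewrite sum_kirchhoff_root pv eq_sym (negPf xv).
rewrite sum_kirchhoff // -psiE //; apply: eq_bigr => d _.
by rewrite !(groundedE _ pv).
Qed.

(** Solve the grounded equation with a unit source at [x] and change the sign; only the equation at
    [v] remains. *)
Lemma unit_flow_ex (x : V) : x != v ->
  exists phi, @unit_flow_potential G R v x phi.
Proof.
move=> xv; have [psi psiE] := green_ex (fun a => (a == x)%:R).
have pv : psi v = 0.
  by rewrite -sum_kirchhoff_root psiE eq_sym (negPf xv).
pose phi : {ffun V -> R} := [ffun a => - psi a].
exists phi.
have phiE a : a != v ->
    \sum_(d : dart G | dtail d == a) (phi a - phi (dhead d)) = - (a == x)%:R.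
  move=> av; rewrite -psiE sum_kirchhoff // -sumrN; apply: eq_bigr => d _.
  by rewrite !(groundedE _ pv) !ffunE opprB opprK addrC.
move=> a; have [->|av] := eqVneq a v; last by rewrite phiE // sub0r.
(* The equation at [v] follows from the others: summed over all vertices, each dart cancels its
   reverse. *)
have : \sum_d (phi (dtail d) - phi (dhead d)) = 0.
  rewrite sumrB -[X in X - _]sum_drev.
  by under eq_bigr do rewrite dtail_rev; rewrite subrr.
rewrite (partition_big (@dtail G) predT) //= (bigD1 v) //=.
rewrite [X in _ + X](_ : _ = - 1); last first.
  rewrite (bigD1 x) //= [X in _ + X]big1 ?addr0 => [|b /andP[bv bx]].
    under eq_bigr => d /eqP tx do rewrite tx.
    by rewrite phiE // eqxx.
  under eq_bigr => d /eqP tx do rewrite tx.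
  by rewrite phiE // (negPf bx) oppr0.
move/eqP; rewrite subr_eq0 => /eqP sv.
rewrite eq_sym (negPf xv) subr0 -[RHS]sv.
by apply: eq_bigr => d /eqP->.
Qed.

(** Whichever potential [xget] returns, [phi v - phi] vanishes at the root and has a unit source at
    the head of [e], so it is a column of [green]. *)
Lemma transfer_impedance_green (e f : dart G) :
  e \in root_darts v -> f \in root_darts v ->
  transfer_impedance R e f = green (dhead e) (dhead f).
Proof.
rewrite !inE => /andP[/eqP te he] /andP[/eqP tf hf].
rewrite /transfer_impedance te tf green_sym.
set phi := xget _ _.
have phiP : @unit_flow_potential G R v (dhead e) phi.
  exact: xgetPex (unit_flow_ex he).
apply: (@green_potential (fun y => phi v - phi y)) => //; first by rewrite subrr.
move=> a av.
transitivity (- \sum_(d | dtail d == a) (phi a - phi (dhead d))).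
  by rewrite -sumrN; apply: eq_bigr => d _; ring.
by rewrite phiP (negPf av) sub0r opprK.
Qed.

Lemma root_mult_solve x :
  \sum_y kirchhoff v 1 x y * (y != v)%:R = (root_mult v x)%:R :> R.
Proof.
rewrite root_mult_sum; have [->|xv] := eqVneq x v.
  rewrite (sum_kirchhoff_root v (fun y => (y != v)%:R)) eqxx.
  by rewrite big1 // => d _; rewrite !andbF.
rewrite (sum_kirchhoff (fun y => (y != v)%:R)) // big_mkcond.
apply: eq_bigr => d _; rewrite !(groundedE (psi := fun y => (y != v)%:R)) ?eqxx //.
by rewrite xv andbT; case: (dtail d == x) (dhead d == v) => [] [] //=;
  rewrite ?subr0 ?subrr.
Qed.

(** The grounded constant 1 has Laplacian [root_mult]. For the random walk from [x], each summand is
    the probability of entering [v] from [y]. *)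
Lemma green_row_sum x : x != v -> \sum_y green x y * (root_mult v y)%:R = 1.
Proof.
move=> xv; rewrite -(green_solve root_mult_solve).
by rewrite xv.
Qed.

Lemma transfer_impedance_row_sum e : e \in root_darts v ->
  \sum_(f in root_darts v) transfer_impedance R e f = 1.
Proof.
move=> eN; have := eN; rewrite inE => /andP[_ /green_row_sum <-].
under [RHS]eq_bigr do rewrite mulrC.
rewrite sum_root_mult; apply: eq_bigr => f fN.
exact: transfer_impedance_green.
Qed.

Lemma transfer_impedance_sym : {in root_darts v &, forall e f,
  transfer_impedance R e f = transfer_impedance R f e}.
Proof. by move=> e f eN fN; rewrite !transfer_impedance_green // green_sym. Qed.

Lemma trace_green : \tr (root_mult_mx *m invmx K) =
  \sum_(e in root_darts v) transfer_impedance R e e.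
Proof.
transitivity (\sum_x (root_mult v x)%:R * green x x).
  rewrite -sum_enum_val; apply: eq_bigr => i _.
  by rewrite mul_diag_mx !mxE /green enum_valK.
by rewrite sum_root_mult; apply: eq_bigr => e eN; rewrite transfer_impedance_green.
Qed.

Lemma trace_green_sqr :
  \tr ((root_mult_mx *m invmx K) *m (root_mult_mx *m invmx K)) =
  \sum_(e in root_darts v) \sum_(f in root_darts v) transfer_impedance R e f ^+ 2.
Proof.
transitivity (\sum_x (root_mult v x)%:R *
    (\sum_y (root_mult v y)%:R * green x y ^+ 2)).
  rewrite -sum_enum_val; apply: eq_bigr => i _.
  rewrite mxE -sum_enum_val big_distrr; apply: eq_bigr => j _.
  rewrite !mul_diag_mx !mxE -!/(green _ _) /= expr2 {2}green_sym /green !enum_valK.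
  by ring.
rewrite sum_root_mult; apply: eq_bigr => e eN.
rewrite sum_root_mult; apply: eq_bigr => f fN.
by rewrite transfer_impedance_green.
Qed.

(** The indicator [one] of the non-root vertices satisfies [one *m K = one *m root_mult_mx], so it
    is a left eigenvector of eigenvalue 1. *)
Lemma det_green_singular x : x != v ->
  \det (1%:M + (- 1) *: (root_mult_mx *m invmx K)) = 0.
Proof.
move=> xv; apply/eqP/det0P.
pose one : 'rV[R]_#|V| := \row_i (enum_val i != v)%:R.
exists one.
  apply/eqP => /rowP/(_ (enum_rank x)); rewrite !mxE enum_rankK xv.
  by move/eqP; rewrite oner_eq0.
have oneK : one *m K = one *m root_mult_mx.
  apply/rowP => j; rewrite mul_mx_diag !mxE.
  transitivity ((root_mult v (enum_val j))%:R : R).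
    rewrite -root_mult_solve -sum_enum_val; apply: eq_bigr => i _.
    by rewrite !mxE mulrC kirchhoff_sym.
  have [->|_] := eqVneq (enum_val j) v; last by rewrite mul1r.
  rewrite mul0r /root_mult; apply/eqP; rewrite pnatr_eq0 cards_eq0.
  by apply/eqP/setP => d; rewrite !inE eqxx !andbF.
rewrite mulmxDr mulmx1 -scalemxAr mulmxA -oneK mulmxK ?kirchhoff_unit //.
by rewrite scaleN1r subrr.
Qed.

Theorem degree_spectrum : exists mu : 'I_#|V| -> R,
  [/\ forall i, 0 <= mu i <= 1,
      forall z, \sum_(T in @spanning_trees G) z ^+ degree T v =
        #|@spanning_trees G|%:R * \prod_i (1 + (z - 1) * mu i),
      \sum_i mu i = \sum_(e in root_darts v) transfer_impedance R e e,
      \sum_i mu i ^+ 2 = \sum_(e in root_darts v) \sum_(f in root_darts v)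
        transfer_impedance R e f ^+ 2 &
      root_darts v != finset.set0 -> exists i, mu i = 1].
Proof.
have m_sym : root_mult_mx^T = root_mult_mx by rewrite tr_diag_mx.
have [mu [mu01 detE trE tr2E]] := generalized_spectrum kirchhoff_mx_sym m_sym
  kirchhoff_unit qform_root_mult_ge0 qform_le qform_def.
exists mu; split=> //.
- by move=> z; rewrite degree_pgf detE.
- by rewrite -trE trace_green.
- by rewrite -tr2E trace_green_sqr.
(* At [t = -1] the determinant vanishes, hence so does some factor [1 - mu i]. *)
move=> /set0Pn[d]; rewrite inE => /andP[_ /det_green_singular].
rewrite detE => /eqP/prodf_eq0[i _]; rewrite mulN1r subr_eq0 => /eqP mui.
by exists i.
Qed.

End Green.

(** * Second moments of the transfer impedances *)

Section NearlyBlockMatrix.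
Variables (R : realType) (I : finType) (A : {set I}) (X : eqType) (hd : I -> X).
Variables (b : X -> R) (m : I -> I -> R) (delta : R).
Hypotheses (A_gt0 : (0 < #|A|)%N) (b_ge0 : forall x, 0 <= b x) (delta_ge0 : 0 <= delta).
Hypothesis m_sym : {in A &, forall i j, m i j = m j i}.
Hypothesis m_row : {in A, forall i, \sum_(j in A) m i j = 1}.
Let c i := #|A|%:R^-1 + b (hd i).
Hypothesis m_near : {in A &, forall i j,
  `|m i j - (#|A|%:R^-1 + (hd i == hd j)%:R * b (hd i))| <=
  delta * (#|A|%:R^-1 + b (hd i))}.
Let S := \sum_(i in A) b (hd i).

Let sum_c : \sum_(i in A) c i = 1 + S.
Proof.
rewrite big_split /= sumr_const -[_^-1 *+ _]mulr_natr mulVf //.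
by rewrite pnatr_eq0 -lt0n.
Qed.

Lemma near_trace : `|\sum_(i in A) m i i - (1 + S)| <= delta * (1 + S).
Proof.
rewrite -sum_c -sumrB mulr_sumr; apply: le_trans (ler_norm_sum _ _ _) _.
by apply: ler_sum => i iA; have := m_near iA iA; rewrite eqxx mul1r.
Qed.

(* The columns of [m] sum to 1, as do those of its constant part. *)
Let block_sum j : j \in A ->
  \sum_(i in A) (hd i == hd j)%:R * b (hd i) <= delta * (1 + S).
Proof.
move=> jA; rewrite -sum_c mulr_sumr.
have -> : \sum_(i in A) (hd i == hd j)%:R * b (hd i) =
    \sum_(i in A) ((#|A|%:R^-1 + (hd i == hd j)%:R * b (hd i)) - m i j).
  rewrite sumrB big_split /= sumr_const -[_^-1 *+ _]mulr_natr mulVf ?pnatr_eq0 -?lt0n //.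
  rewrite [X in _ - X](_ : _ = 1); first by ring.
  by rewrite -(m_row jA); apply: eq_bigr => i iA; exact: m_sym.
apply: ler_sum => i iA; apply: le_trans (ler_norm _) _.
by rewrite distrC; exact: m_near.
Qed.

(** Write one factor of [m i j ^+ 2] as constant part, block part and error. The constant part sums
    to 1 by the row sums, the block part is small by [block_sum], and the error carries a factor
    [delta]. *)
Lemma near_trace_sqr : \sum_(i in A) \sum_(j in A) m i j ^+ 2 <=
  1 + 2 * (delta * (1 + delta) * (1 + S) ^+ 2).
Proof.
have m_le i j : i \in A -> j \in A -> `|m i j| <= (1 + delta) * c i.
  move=> iA jA; have := m_near iA jA; set t := _ + _ * _; rewrite -/(c i) => near.
  have t0 : 0 <= t by rewrite addr_ge0 ?mulr_ge0 ?invr_ge0.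
  have tc : t <= c i by rewrite lerD2l; case: (_ == _); rewrite ?mul1r ?mul0r.
  rewrite -[m i j](subrK t); apply: le_trans (ler_normD _ _) _.
  by rewrite (ger0_norm t0); lra.
have term i j : i \in A -> j \in A -> m i j ^+ 2 <=
    m i j * #|A|%:R^-1 + (1 + delta) * c i * ((hd j == hd i)%:R * b (hd j))
    + delta * (1 + delta) * (c i * c j).
  move=> iA jA.
  have -> : m i j ^+ 2 = m i j * #|A|%:R^-1 + m i j * ((hd i == hd j)%:R * b (hd i))
    + m i j * (m i j - (#|A|%:R^-1 + (hd i == hd j)%:R * b (hd i))) by ring.
  apply: lerD; first apply: lerD => //.
    have -> : (hd j == hd i)%:R * b (hd j) = (hd i == hd j)%:R * b (hd i).
      by rewrite eq_sym; case: eqP => [->|]; rewrite ?mul0r.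
    apply: ler_wpM2r; first by rewrite mulr_ge0.
    by apply: le_trans (ler_norm _) _; exact: m_le.
  apply: le_trans (ler_norm _) _; rewrite normrM.
  (* Symmetry lets [m i j] be bounded through [c j] while the error uses [c i], so the double sum
     factors. *)
  have -> : delta * (1 + delta) * (c i * c j) =
    ((1 + delta) * c j) * (delta * c i) by ring.
  apply: ler_pM => //; last exact: m_near.
  by rewrite (m_sym iA jA); exact: m_le.
have -> : 1 + 2 * (delta * (1 + delta) * (1 + S) ^+ 2) =
    1 + (1 + delta) * (1 + S) * (delta * (1 + S))
    + delta * (1 + delta) * ((1 + S) * (1 + S)) by ring.
apply: (@le_trans _ _ (\sum_(i in A) (#|A|%:R^-1
    + (1 + delta) * c i * (delta * (1 + S)) + delta * (1 + delta) * (c i * (1 + S))))).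
  apply: ler_sum => i iA.
  apply: le_trans (ler_sum _ (fun j jA => term i j iA jA)) _.
  rewrite !big_split /= -mulr_suml m_row // mul1r -!mulr_sumr sum_c.
  rewrite lerD2r lerD2l; apply: ler_wpM2l; last exact: block_sum.
  by rewrite mulr_ge0 // addr_ge0.
rewrite !big_split /= sumr_const -[_^-1 *+ _]mulr_natr mulVf ?pnatr_eq0 -?lt0n //.
by rewrite -mulr_suml -!mulr_sumr -mulr_suml sum_c.
Qed.

End NearlyBlockMatrix.

(** * The impedance hypothesis at the root *)

Section RootStar.
Variables (R : realType) (G : mgraph) (v : vertex G).

Lemma deg_star_root : deg_star v = #|root_darts v|.
Proof.
rewrite /deg_star -(@card_in_imset _ _ fst (mem (root_darts v))).
  apply: eq_card => e; rewrite inE; apply/idP/imsetP => [/andP[ne]|[[e' s] + ->]].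
    case/orP => [/eqP ev|/eqP ev].
      by exists (e, true) => //; rewrite inE /dtail /dhead /= ev eqxx -ev eq_sym.
    by exists (e, false) => //; rewrite inE /dtail /dhead /= ev eqxx -ev.
  rewrite inE /dtail /dhead /=; case: s => /andP[/eqP <- ne].
    by rewrite eq_sym ne eqxx.
  by rewrite ne eqxx orbT.
move=> d d' dN d'N e; have [//|ed] := same_edge e.
move: dN d'N; rewrite ed !inE dtail_rev => /andP[_ hd] /andP[td _].
by rewrite td in hd.
Qed.

(** Two darts out of [v] are always co-oriented, and their common endpoints are [v] and possibly a
    shared head. The absolute value of [C] makes the error factor nonnegative. *)
Lemma impedance_near (C eps : R) : 0 < eps ->
  (forall e f : dart G,
      dtail e != dhead e -> dtail f != dhead f ->
      dtail e \in closed_nbhd v -> dhead e \in closed_nbhd v ->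
      dtail f \in closed_nbhd v -> dhead f \in closed_nbhd v ->
      {subset neighbors (dtail e) <= closed_nbhd v} ->
      co_oriented e f ->
      `| transfer_impedance R e f
         - \sum_(q in (endpoints e :&: endpoints f)%SET) (deg_star q)%:R^-1 |
      <= C * eps * \sum_(q in endpoints e) (deg_star q)%:R^-1) ->
  {in root_darts v &, forall e f,
    `|transfer_impedance R e f - (#|root_darts v|%:R^-1 +
        (dhead e == dhead f)%:R * (deg_star (dhead e))%:R^-1)| <=
    (`|C| * eps) * (#|root_darts v|%:R^-1 + (deg_star (dhead e))%:R^-1)}.
Proof.
move=> eps_gt0 bound e f eN fN.
have nbh d : d \in root_darts v -> dhead d \in closed_nbhd v.
  by move=> dN; rewrite inE map_f ?orbT // mem_enum.
have := eN; have := fN; rewrite !inE => /andP[/eqP tf hf] /andP[/eqP te he].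
have sum_end : \sum_(q in endpoints e) ((deg_star q)%:R^-1 : R) =
    #|root_darts v|%:R^-1 + (deg_star (dhead e))%:R^-1.
  rewrite /endpoints te big_setU1 ?inE 1?eq_sym //= big_set1.
  by rewrite deg_star_root.
have sum_int : \sum_(q in (endpoints e :&: endpoints f)%SET) ((deg_star q)%:R^-1 : R) =
    #|root_darts v|%:R^-1 + (dhead e == dhead f)%:R * (deg_star (dhead e))%:R^-1.
  have [ef|ef] := eqVneq (dhead e) (dhead f).
    have -> : endpoints f = endpoints e by rewrite /endpoints te tf ef.
    by rewrite finset.setIid sum_end mul1r.
  rewrite mul0r addr0 (_ : (_ :&: _)%SET = [set v]%SET) ?big_set1 ?deg_star_root //.
  apply/setP => q; rewrite !inE te tf; case: (eqVneq q v) => //= qv.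
  by apply/andP => -[/eqP -> /eqP]; apply/eqP.
have := bound e f; rewrite te tf sum_int sum_end.
move=> /(_ _ _ _ _ _ _ _ _)/(le_trans); apply.
- by rewrite eq_sym.
- by rewrite eq_sym.
- exact: mem_head.
- exact: nbh.
- exact: mem_head.
- exact: nbh.
- by move=> x xv; rewrite inE xv orbT.
- move=> q; rewrite !inE te tf.
  case: (eqVneq q v) => [->|qv] /=; first by left.
  by move=> /andP[/eqP -> /eqP ->]; right.
apply: ler_wpM2r; first by rewrite addr_ge0 // invr_ge0.
by apply: ler_wpM2r; [exact: ltW|exact: ler_norm].
Qed.

End RootStar.

(** * Poisson limits through generating functions *)

Section PoissonLimit.
Variable R : realType.

(* [1 - x >= exp (- x / (1 - x))] and [x / (1 - x) <= x + x ^ 2 / z] when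
   [z <= 1 - x]. *)
Lemma expR_le_1B (x z : R) : 0 <= x -> 0 < z -> x <= 1 - z ->
  expR (- (x + x ^+ 2 / z)) <= 1 - x.
Proof.
move=> x0 z0 xz; have x1 : 0 < 1 - x by lra.
apply: (@le_trans _ _ (expR (- (x / (1 - x))))).
  rewrite ler_expR lerN2.
  have -> : x / (1 - x) = x + x ^+ 2 / (1 - x) by field; rewrite gt_eqF.
  rewrite lerD2l ler_wpM2l ?sqr_ge0 // lef_pV2 ?posrE //; lra.
rewrite expRN -[leRHS]invrK lef_pV2 ?posrE ?expR_gt0 ?invr_gt0 //.
rewrite [leLHS](_ : _ = 1 + x / (1 - x)); last by field; rewrite gt_eqF.
exact: expR_ge1Dx.
Qed.

(** The factor of [i0] is exactly [z]. Any other is [1 - x] with [x = (1 - z) * mu i <= 1 - z],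
    hence between [expR (- (x + x ^+ 2 / z))] and [expR (- x)]. *)
Lemma bernoulli_pgf_bounds n (mu : 'I_n -> R) (i0 : 'I_n) (z : R) :
  (forall i, 0 <= mu i <= 1) -> mu i0 = 1 -> 0 < z < 1 ->
  z * expR (- ((1 - z) * (\sum_i mu i - 1) + z^-1 * (\sum_i mu i ^+ 2 - 1)))
    <= \prod_i (1 + (z - 1) * mu i) <=
  z * expR (- ((1 - z) * (\sum_i mu i - 1))).
Proof.
move=> mu01 mu1 /andP[z0 z1].
have s1E : \sum_i mu i - 1 = \sum_(i | i != i0) mu i.
  by rewrite (bigD1 i0) //= mu1; ring.
have s2E : \sum_i mu i ^+ 2 - 1 = \sum_(i | i != i0) mu i ^+ 2.
  by rewrite (bigD1 i0) //= mu1; ring.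
rewrite [X in _ <= X <= _](bigD1 i0) //= mu1 mulr1 (_ : 1 + (z - 1) = z); last by ring.
rewrite s1E s2E !ler_pM2l //; apply/andP; split.
  rewrite !mulr_sumr -big_split -sumrN expR_sum /=; apply: ler_prod => i _.
  rewrite expR_ge0 /=; have /andP[m0 m1] := mu01 i.
  have -> : 1 + (z - 1) * mu i = 1 - (1 - z) * mu i by ring.
  have x0 : 0 <= (1 - z) * mu i by rewrite mulr_ge0 // subr_ge0 ltW.
  have xz : (1 - z) * mu i <= 1 - z by rewrite ler_piMr // subr_ge0 ltW.
  apply: le_trans (expR_le_1B x0 z0 xz).
  rewrite ler_expR lerN2 lerD2l mulrC ler_pM2l ?invr_gt0 // exprMn.
  by rewrite ler_piMl ?sqr_ge0 // exprn_ile1; lra.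
rewrite !mulr_sumr -sumrN expR_sum; apply: ler_prod => i _.
have /andP[m0 m1] := mu01 i; apply/andP; split.
  have -> : 1 + (z - 1) * mu i = (1 - mu i) + z * mu i by ring.
  by rewrite addr_ge0 ?subr_ge0 // mulr_ge0 // ltW.
apply: le_trans (expR_ge1Dx _); lra.
Qed.

Lemma bernoulli_pgf_cvg (n : nat -> nat) (mu : forall k, 'I_(n k) -> R)
    (lambda z : R) : 0 < z < 1 ->
  (\forall k \near \oo, (forall i, 0 <= mu k i <= 1) /\ exists i, mu k i = 1) ->
  \sum_i mu k i @[k --> \oo] --> 1 + lambda ->
  \sum_i mu k i ^+ 2 @[k --> \oo] --> (1 : R) ->
  \prod_i (1 + (z - 1) * mu k i) @[k --> \oo] --> z * expR (- ((1 - z) * lambda)).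
Proof.
move=> z01 mu_near s1_cvg s2_cvg.
have s1' : \sum_i mu k i - 1 @[k --> \oo] --> lambda.
  rewrite (_ : lambda = (1 + lambda) - 1); last by ring.
  by apply: cvgB => //; exact: cvg_cst.
have s2' : \sum_i mu k i ^+ 2 - 1 @[k --> \oo] --> (0 : R).
  by rewrite -[X in _ --> X](subrr (1 : R)); apply: cvgB => //; exact: cvg_cst.
have upper : z * expR (- ((1 - z) * (\sum_i mu k i - 1))) @[k --> \oo]
    --> z * expR (- ((1 - z) * lambda)).
  apply: cvgMr; apply: continuous_cvg; first exact: continuous_expR.
  by apply: cvgN; apply: cvgMr.
apply: squeeze_cvgr upper.
  near=> k; have [mu01 [i0 mui]] : (forall i, 0 <= mu k i <= 1) /\ exists i, mu k i = 1.
    by near: k.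
  exact: bernoulli_pgf_bounds mui z01.
apply: cvgMr; apply: continuous_cvg; first exact: continuous_expR.
apply: cvgN; rewrite -[X in _ --> X]addr0; apply: cvgD; first exact: cvgMr.
by rewrite -[X in _ --> X](mulr0 z^-1); apply: cvgMr.
Unshelve. all: by end_near. Qed.

(** Induction on [J]: subtracting the lower coefficients and dividing by [z ^+ J] leaves coefficient
    [J] up to [2 * z], uniformly in [k], so [z] can be fixed before [k] grows. *)
Lemma coef_cvg (q : nat -> nat -> R) (p : nat -> R -> R) (a : nat -> R) (F : R -> R) :
  (forall k J (z : R), 0 < z <= 2^-1 ->
     `|p k z - \sum_(j < J) q k j * z ^+ j| <= 2 * z ^+ J) ->
  (forall J (z : R), 0 < z <= 2^-1 -> `|F z - \sum_(j < J) a j * z ^+ j| <= 2 * z ^+ J) ->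
  (forall z : R, 0 < z <= 2^-1 -> p k z @[k --> \oo] --> F z) ->
  forall J, q k J @[k --> \oo] --> a J.
Proof.
move=> p_tail F_tail p_cvg J; elim/ltn_ind: J => J IH.
apply/cvgrPdist_le => /= e e0.
(* Each of the two remainders is then at most [e / 4], leaving [e / 2] for the convergence at
   [z]. *)
pose z := Num.min 2^-1 (e / 8).
have z0 : 0 < z by rewrite lt_min; lra.
have zh : z <= 2^-1 by rewrite ge_min lexx.
have ze : z <= e / 8 by rewrite ge_min lexx orbT.
have z01 : 0 < z <= 2^-1 by rewrite z0.
have zJ0 : 0 < z ^+ J by exact: exprn_gt0.
have rem (x S c : R) : `|x - (S + c * z ^+ J)| <= 2 * z ^+ J.+1 ->
    `|(x - S) / z ^+ J - c| <= 2 * z.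
  move=> h; rewrite -(ler_pM2r zJ0).
  rewrite -[X in _ * X](gtr0_norm zJ0) -normrM mulrBl divfK ?gt_eqF //.
  by rewrite -mulrA -exprS -addrA -opprD.
have near_u : (p k z - \sum_(j < J) q k j * z ^+ j) / z ^+ J @[k --> \oo]
    --> (F z - \sum_(j < J) a j * z ^+ j) / z ^+ J.
  apply: cvgMl; apply: cvgB; first exact: p_cvg.
  apply: cvg_big => [|j _]; first exact: add_continuous.
  by apply: cvgMl; exact: IH.
have e2 : 0 < e / 2 by lra.
move/cvgrPdist_le : near_u => /(_ _ e2) near_u.
near=> k.
have := F_tail J.+1 z z01; rewrite big_ord_recr /= => /rem.
have := p_tail k J.+1 z z01; rewrite big_ord_recr /= => /rem.
have : `|(F z - \sum_(j < J) a j * z ^+ j) / z ^+ J -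
    (p k z - \sum_(j < J) q k j * z ^+ j) / z ^+ J| <= e / 2 by near: k.
rewrite !ler_norml; set W := (F z - _) / _; set U := (p k z - _) / _.
move=> /andP[? ?] /andP[? ?] /andP[? ?]; by apply/andP; split; lra.
Unshelve. all: by end_near. Qed.

(** The law of one plus a Poisson variable, the limit of the tree degree itself. *)
Definition shifted_pmf (lambda : R) (j : nat) : R :=
  if j is j'.+1 then poisson_pmf lambda j' else 0.

Lemma poisson_pmf_le1 (lambda : R) j : poisson_pmf lambda j <= 1.
Proof.
rewrite /poisson_pmf; case: ifP => // l0.
rewrite expRN ler_pdivrMr ?expR_gt0 // mul1r.
case: j => [|j]; first by rewrite expr0 fact0 invr1 mulr1 -expR0 ler_expR ltW.
by apply: le_trans (expR_ge1Dxn j (ltW l0)); rewrite lerDr.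
Qed.

Lemma shifted_pmf_ge0 lambda j : 0 <= shifted_pmf lambda j.
Proof. by case: j => [|j] //=; exact: poisson_pmf_ge0. Qed.

Lemma shifted_pmf_le1 lambda j : shifted_pmf lambda j <= 1.
Proof. by case: j => [|j] //=; exact: poisson_pmf_le1. Qed.

Lemma shifted_pmf_series (lambda z : R) : 0 < lambda ->
  \sum_(j < n.+1) shifted_pmf lambda j * z ^+ j @[n --> \oo]
    --> z * expR (- ((1 - z) * lambda)).
Proof.
move=> l0.
have -> : z * expR (- ((1 - z) * lambda)) = z * expR (- lambda) * expR (lambda * z).
  by rewrite -mulrA -expRD; congr (_ * expR _); ring.
have -> : (fun n => \sum_(j < n.+1) shifted_pmf lambda j * z ^+ j) =
    (fun n => z * expR (- lambda) * series (exp_coeff (lambda * z)) n).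
  apply/funext => n; rewrite big_ord_recl /= mul0r add0r /series /= big_mkord.
  rewrite mulr_sumr; apply: eq_bigr => i _.
  by rewrite /poisson_pmf l0 /exp_coeff /= exprS exprMn; ring.
by apply: cvgMr; exact: is_cvg_series_exp_coeff.
Qed.

(** The coefficients lie in [0, 1], so the tail is dominated by a geometric series of ratio at most
    1/2. *)
Lemma shifted_pmf_tail (lambda z : R) J : 0 < lambda -> 0 < z <= 2^-1 ->
  `|z * expR (- ((1 - z) * lambda)) - \sum_(j < J) shifted_pmf lambda j * z ^+ j|
    <= 2 * z ^+ J.
Proof.
move=> l0 /andP[z0 zh].
set S := fun n => \sum_(j < n) shifted_pmf lambda j * z ^+ j.
have geo m : \sum_(j < m) z ^+ j <= 2.
  have : (1 - z) * \sum_(j < m) z ^+ j <= 1.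
    by rewrite -opprB mulNr -subrX1 opprB gerBl exprn_ge0 // ltW.
  have : 0 <= \sum_(j < m) z ^+ j by apply: sumr_ge0 => j _; rewrite exprn_ge0 // ltW.
  set g := \sum_(_ < _) _ => g0 zg; nra.
have tail m : 0 <= S (J + m)%N - S J <= 2 * z ^+ J.
  rewrite /S big_split_ord /= addrC addrK; apply/andP; split.
    by apply: sumr_ge0 => j _; rewrite mulr_ge0 ?shifted_pmf_ge0 // exprn_ge0 // ltW.
  apply: (@le_trans _ _ (\sum_(j < m) z ^+ j * z ^+ J)).
    apply: ler_sum => j _; rewrite exprD [z ^+ J * _]mulrC.
    by rewrite ler_piMl ?shifted_pmf_le1 // mulr_ge0 // exprn_ge0 // ltW.
  by rewrite -mulr_suml ler_wpM2r // exprn_ge0 // ltW.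
have S_cvg := @shifted_pmf_series lambda z l0.
have SJ_cvg : S n.+1 - S J @[n --> \oo] -->
    z * expR (- ((1 - z) * lambda)) - S J by apply: cvgB => //; exact: cvg_cst.
rewrite -(cvg_lim _ SJ_cvg) //.
rewrite ler_norml; apply/andP; split.
- apply: (@le_trans _ _ 0).
    by rewrite lerNl oppr0 mulr_ge0 // exprn_ge0 // ltW.
  apply: limr_ge; first by apply/cvg_ex; eexists; exact: SJ_cvg.
  near=> n; have Jn : (J <= n)%N by near: n; exact: nbhs_infty_ge.
  have -> : n.+1 = (J + (n.+1 - J))%N by rewrite subnKC // leqW.
  by case/andP: (tail (n.+1 - J)%N).
- apply: limr_le; first by apply/cvg_ex; eexists; exact: SJ_cvg.
  near=> n; have Jn : (J <= n)%N by near: n; exact: nbhs_infty_ge.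
  have -> : n.+1 = (J + (n.+1 - J))%N by rewrite subnKC // leqW.
  by case/andP: (tail (n.+1 - J)%N).
Unshelve. all: by end_near. Qed.

End PoissonLimit.

(** * The law of the degree of the root *)

Section RootDegree.
Variables (R : realType) (G : mgraph) (v : vertex G).

Definition root_degree_prob (j : nat) : R :=
  #|[set t in @spanning_trees G | degree t v == j]%SET|%:R / #|@spanning_trees G|%:R.

Lemma sum_root_degree_prob (N : nat) (w : nat -> R) :
  \sum_(j < N) root_degree_prob j * w j =
  \sum_(t in @spanning_trees G | (degree t v < N)%N) w (degree t v)
    / #|@spanning_trees G|%:R.
Proof.
transitivity (\sum_(j < N) \sum_(t in @spanning_trees G)
    if degree t v == j then w (degree t v) / #|@spanning_trees G|%:R else 0).
  apply: eq_bigr => j _; rewrite -big_mkcondr /=.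
  under eq_bigr => t /andP[_ /eqP ->] do [].
  rewrite /root_degree_prob sumr_const -[RHS]mulr_natl mulrAC -mulrA.
  by congr (_%:R * _); apply: eq_card => t; rewrite [LHS]inE.
rewrite exchange_big /= [RHS]big_mkcondr /=; apply: eq_bigr => t _.
rewrite -big_mkcond /=; case: ltnP => [tN|Nt].
  rewrite (bigD1 (Ordinal tN)) //= big1 ?addr0 // => j /andP[/eqP tj].
  by rewrite -val_eqE /= tj eqxx.
rewrite big1 // => j /eqP tj; by have := ltn_ord j; rewrite -tj ltnNge Nt.
Qed.

(** Only trees with root degree at least [J] remain, each weighing at most [z ^+ J]; the factor 2
    matches [coef_cvg]. *)
Lemma degree_pgf_tail (z : R) (J : nat) : connected_graph G -> 0 < z <= 2^-1 ->
  `|(\sum_(t in @spanning_trees G) z ^+ degree t v) / #|@spanning_trees G|%:R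
    - \sum_(j < J) root_degree_prob j * z ^+ j| <= 2 * z ^+ J.
Proof.
move=> Gc /andP[z0 zh].
have ST0 : 0 < #|@spanning_trees G|%:R :> R.
  by rewrite ltr0n (spanning_trees_gt0 v).
rewrite sum_root_degree_prob (bigID (fun t => (degree t v < J)%N)) /= mulrDl mulr_suml.
rewrite addrC addKr ger0_norm; last first.
  by rewrite divr_ge0 // sumr_ge0 // => t _; rewrite exprn_ge0 // ltW.
rewrite ler_pdivrMr //; apply: (@le_trans _ _ (\sum_(t in @spanning_trees G) z ^+ J)).
  rewrite big_mkcondr; apply: ler_sum => t _; case: ifP => [|_].
    by rewrite -leqNgt => Jt; rewrite ler_wiXn2l //; lra.
  by rewrite exprn_ge0 // ltW.
rewrite sumr_const -[leLHS]mulr_natr ler_pM2r // ler_peMl ?exprn_ge0 ?ltW //; lra.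
Qed.

Lemma degree_cdf d (Omega : measurableType d) (P : probability Omega R)
    (T : {RV P >-> subgraph G}) (D : {RV P >-> R}) (r : R) :
  is_ust T -> (forall w, 1 + D w = (degree (T w) v)%:R) ->
  cdf D r = (\sum_(j < Num.truncn (r + 2)) root_degree_prob j)%:E.
Proof.
move=> Tust Ddeg; set N := Num.truncn _.
(* [D w <= r] amounts to [degree + 1 <= r + 2], where the left side is a natural number. *)
have DN w : (D w <= r) = (degree (T w) v < N)%N.
  rewrite truncn_gt_nat -natr1 -Ddeg; apply/idP/idP; lra.
pose F (t : {set edge G}) : set Omega := T @^-1` [set t].
rewrite /cdf /distribution /pushforward.
pose r0 := enum [pred t : {set edge G} | (degree t v < N)%N].
have -> : D @^-1` `]-oo, r] = \bigcup_(t in [set` r0]) F t.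
  apply/seteqP; split => w /=; rewrite in_itv /= DN.
    by move=> h; exists (T w) => //=; rewrite mem_enum.
  by move=> [t tN Tw]; move: tN; rewrite /= mem_enum -Tw.
rewrite measure_fin_bigcup; [|exact: finite_seq| |].
- rewrite -fsbig_seq ?enum_uniq // big_enum /=.
  under eq_bigr do rewrite Tust.
  rewrite sumEFin; congr (_%:E).
  under [RHS]eq_bigr do rewrite -[root_degree_prob _]mulr1.
  rewrite (sum_root_degree_prob N (fun _ => 1)) [RHS]big_mkcond [LHS]big_mkcond /=.
  apply: eq_bigr => t _; rewrite inE mul1r.
  by case: (t \in _); case: (_ < _)%N.
- by move=> t t' _ _ [w [Tt Tt']]; rewrite -[t]Tt -[t']Tt'.
- by move=> t _; rewrite /F -[X in measurable X]setTI; exact: measurable_funP.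
Qed.

End RootDegree.

Lemma poisson_cdf (R : realType) (lambda r : R) : 0 < lambda ->
  cdf (poisson_rv lambda) r =
  (\sum_(j < Num.truncn (r + 2)) shifted_pmf lambda j)%:E.
Proof.
move=> l0; rewrite /cdf /distribution /pushforward /poisson_rv.
set N := Num.truncn _.
(* The predecessor undoes the shift in [shifted_pmf]; for [N = 0] both sums are empty. *)
have nN n : (n < N.-1)%N = (n%:R <= r).
  have -> : (n < N.-1)%N = (n.+1 < N)%N by case: N.
  by rewrite truncn_gt_nat -!natr1; apply/idP/idP; lra.
have -> : (@nat_to_real R) @^-1` `]-oo, r] = `I_N.-1.
  by apply/seteqP; split => n /=; rewrite in_itv /= /nat_to_real nN.
rewrite [LHS](_ : _ = \esum_(k in `I_N.-1) (poisson_pmf lambda k)%:E); last first.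
  by rewrite /= /poisson_prob l0.
rewrite esum_fset //; last first.
  by move=> n _; rewrite lee_fin poisson_pmf_ge0.
rewrite -fsbig_ord sumEFin; congr (_%:E).
case: N {nN} => [|N] /=; first by rewrite !big_ord0.
by rewrite big_ord_recl /= add0r.
Qed.

(** * Assembly of the Poisson limit *)

(** Chooses the eigenvalues for all [k] at once, although their index type varies with [k]. *)
Lemma dependent_fun_choice (I : Type) (T : I -> Type) (Q : forall i, T i -> Prop) :
  (forall i, exists x, Q i x) -> exists f : forall i, T i, forall i, Q i (f i).
Proof. by move=> QT; exists (fun i => sval (cid (QT i))) => i; case: cid. Qed.

Theorem theorem5p1 (R : realType)
    (G : nat -> mgraph) (v : forall k, vertex (G k))
    (G_connected : forall k, connected_graph (G k))
    (d : nat -> measure_display) (Omega : forall k, measurableType (d k))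
    (P : forall k, probability (Omega k) R)
    (T : forall k, {RV (P k) >-> subgraph (G k)})
    (T_ust : forall k, is_ust (T k))
    (D : forall k, {RV (P k) >-> R})
    (D_degree : forall k w, 1 + D k w = (degree (T k w) (v k))%:R)
    (eps : nat -> R)
    (eps_gt0 : forall k, 0 < eps k)
    (eps_to0 : eps k @[k --> \oo] --> (0 : R))
    (C : R)
    (impedance_bound : forall k (e f : dart (G k)),
      dtail e != dhead e -> dtail f != dhead f ->
      dtail e \in closed_nbhd (v k) -> dhead e \in closed_nbhd (v k) ->
      dtail f \in closed_nbhd (v k) -> dhead f \in closed_nbhd (v k) ->
      {subset neighbors (dtail e) <= closed_nbhd (v k)} ->
      co_oriented e f ->
      `| transfer_impedance R e f
         - \sum_(q in (endpoints e :&: endpoints f)%SET) (deg_star q)%:R^-1 |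
      <= C * eps k * \sum_(q in endpoints e) (deg_star q)%:R^-1)
    (lambda : R)
    (lambda_gt0 : 0 < lambda)
    (degree_sum : \sum_(w <- neighbors (v k)) ((deg_star w)%:R^-1 : R)
      @[k --> \oo] --> lambda) :
  cvg_in_distribution D (poisson_rv lambda).
Proof.
pose N k := root_darts (v k).
pose b k (x : vertex (G k)) : R := (deg_star x)%:R^-1.
pose S k := \sum_(e in N k) b k (dhead e).
have S_cvg : S k @[k --> \oo] --> lambda.
  rewrite (_ : S = (fun k => \sum_(w <- neighbors (v k)) (deg_star w)%:R^-1)) //.
  by apply/funext => k; rewrite sum_neighbors.
pose delta k := `|C| * eps k.
have delta_cvg : delta k @[k --> \oo] --> (0 : R).
  by rewrite -[X in _ --> X](mulr0 `|C|); exact: cvgMr.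
have delta_ge0 k : 0 <= delta k by rewrite mulr_ge0 // ltW.
have spec k := @degree_spectrum R (G k) (v k) (G_connected k).
have [mu muP] := dependent_fun_choice spec.
(* Without edges at the root [S k] would be 0, which is not close to [lambda > 0]. *)
have N_near : \forall k \near \oo, N k != finset.set0.
  move/cvgrPdist_lt : S_cvg => /(_ _ lambda_gt0) S_near.
  near=> k; apply/eqP => N0.
  have : `|lambda - S k| < lambda by near: k.
  by rewrite /S N0 big_set0 subr0 gtr0_norm // ltxx.
have mu_near : \forall k \near \oo,
    (forall i, 0 <= mu k i <= 1) /\ exists i, mu k i = 1.
  near=> k; have [mu01 _ _ _ mu1] := muP k; split=> //; apply: mu1.
  by near: k.
have near_m k : {in N k &, forall e f, `|transfer_impedance R e f -
    (#|N k|%:R^-1 + (dhead e == dhead f)%:R * b k (dhead e))| <=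
    delta k * (#|N k|%:R^-1 + b k (dhead e))}.
  exact: impedance_near (@impedance_bound k).
have b_ge0 k x : 0 <= b k x by rewrite invr_ge0.
have N_card k : N k != finset.set0 -> (0 < #|N k|)%N by rewrite card_gt0.
have delta_S : delta k * (1 + S k) @[k --> \oo] --> (0 : R).
  rewrite -[X in _ --> X](mul0r (1 + lambda)); apply: cvgM => //.
  by apply: cvgD => //; exact: cvg_cst.
have s1_cvg : \sum_i mu k i @[k --> \oo] --> 1 + lambda.
  have S1 : 1 + S k @[k --> \oo] --> 1 + lambda.
    by apply: cvgD => //; exact: cvg_cst.
  apply: (@squeeze_cvgr _ _ _ _ (fun k => 1 + S k - delta k * (1 + S k))
      (fun k => 1 + S k + delta k * (1 + S k))).
  - near=> k; have Nk : N k != finset.set0 by near: k.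
    have [_ _ -> _ _] := muP k.
    have := @near_trace _ _ _ _ _ (b k) _ _ (N_card _ Nk) (near_m k).
    by rewrite ler_distl.
  - by rewrite -[X in _ --> X]subr0; exact: cvgB.
  - by rewrite -[X in _ --> X]addr0; exact: cvgD.
have s2_cvg : \sum_i mu k i ^+ 2 @[k --> \oo] --> (1 : R).
  apply: (@squeeze_cvgr _ _ _ _ (fun=> 1)
      (fun k => 1 + 2 * (delta k * (1 + delta k) * (1 + S k) ^+ 2))).
  - near=> k; have Nk : N k != finset.set0 by near: k.
    have [_ _ _ s2E /(_ Nk)[i mui]] := muP k; apply/andP; split.
      (* The eigenvalue 1 alone gives the lower bound. *)
      rewrite (bigD1 i) //= mui expr1n lerDl sumr_ge0 // => j _; exact: sqr_ge0.
    rewrite s2E; apply: (@near_trace_sqr _ _ _ _ _ (b k) _ _ (N_card _ Nk)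
      (b_ge0 k) (delta_ge0 k) _ _ (near_m k)).
      exact: transfer_impedance_sym.
    by move=> e; exact: transfer_impedance_row_sum.
  - exact: cvg_cst.
  - rewrite -[X in _ --> X]addr0; apply: cvgD; first exact: cvg_cst.
    rewrite -[X in _ --> X](mulr0 2); apply: cvgMr.
    (* Regrouped so that one factor tends to 0 and the other has a finite limit. *)
    rewrite (_ : (fun k => _) = (fun k => (delta k * (1 + S k)) *
        ((1 + delta k) * (1 + S k)))); last by apply/funext => k; ring.
    rewrite -[X in _ --> X](mul0r ((1 + 0) * (1 + lambda))); apply: cvgM => //.
    by apply: cvgM; apply: cvgD => //; exact: cvg_cst.
pose p k (z : R) := (\sum_(t in @spanning_trees (G k)) z ^+ degree t (v k)) /
  #|@spanning_trees (G k)|%:R.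
have pE k z : p k z = \prod_i (1 + (z - 1) * mu k i).
  rewrite /p; have [_ -> _ _ _] := muP k; rewrite mulrAC divff ?mul1r //.
  by rewrite pnatr_eq0 -lt0n (spanning_trees_gt0 (v k)).
have coef j : root_degree_prob R (v k) j @[k --> \oo] --> shifted_pmf lambda j.
  apply: (@coef_cvg R (fun k => root_degree_prob R (v k)) p _
    (fun z => z * expR (- ((1 - z) * lambda)))).
  - by move=> k J z; exact: degree_pgf_tail.
  - by move=> J z; exact: shifted_pmf_tail.
  - move=> z /andP[z0 zh]; under eq_cvg do rewrite pE.
    by apply: bernoulli_pgf_cvg => //; rewrite z0 /=; lra.
move=> r _; rewrite poisson_cdf //.
(* At a given [r], both distribution functions sum over the same finite range of [j], so termwise
   convergence is enough. *)
under eq_cvg => k do rewrite (degree_cdf r (T_ust k) (D_degree k)).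
apply: cvg_EFin; first by near=> k.
rewrite /=; apply: cvg_big => [|j _]; first exact: add_continuous.
exact: coef.
Unshelve. all: by end_near. Qed.
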